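(* Let $M$ be a weakly $\omega$-saturated model in which algebraic closure satisfies the Steinitz exchange property and which has weak elimination of imaginaries. Then $Th(M)$ is thorn-minimal and has global $U^{\text{th}}$-rank $1$. Moreover, $U^{\text{th}}(A)=\dim^{\mathrm{alg}}(A)$ for every finite tuple $A$ of elements of $M$.
   Context: Let $\mathcal C$ be a monster model of $Th(M)$ containing $M$; $M^1$ denotes the set of single elements of $M$ (home sort). Algebraic closure in $M$: for $A\subseteq M$, $acl^M(A)$ is the set of $b\in M$ such that $tp(b/A)$ has finitely many realizations in $M$. Exchange: for single elements $a,b$ and a set $A$, if $a\in acl(Ab)\setminus acl(A)$ then $b\in acl(Aa)$. $\dim^{\mathrm{alg}}(A)$ is the cardinality of a maximal algebraically independent subset (over $\emptyset$) of $A$. Weak $\omega$-saturation: $M$ is weakly $\omega$-saturated if for every $c\in M$ and every formula $\phi(x_1,\dots,x_n;c)$, if there are $a_1,\dots,a_n\in\mathcal C$ with $\mathcal C\models\phi(a_1,\dots,a_n;c)$ and $a_i\notin acl(a_{i+1},\dots,a_n,c)$ for all $i$, then there are $b_1,\dots,b_n\in M$ with $M\models\phi(b_1,\dots,b_n;c)$ and $b_i\notin acl^M(b_{i+1},\dots,b_n,c)$ for all $i$. Elimination of imaginaries: $M$ has weak elimination of imaginaries if $Th(M)$ has geometric elimination of imaginaries, i.e. for any model $N\models Th(M)$ and any imaginary $e\in dcl^{eq}(N)$ there is a finite $x\subset N$ with $acl^{eq}(e)=acl^{eq}(x)$. Thorn-forking (in $\mathcal C^{eq}$): $\delta(x,a)$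 strongly divides over $A$ if $tp(a/A)$ is non-algebraic and $\{\delta(x,a')\}_{a'\models tp(a/A)}$ is $k$-inconsistent for some $k\in\mathbb N$; $\delta(x,a)$ thorn-divides over $A$ if it strongly divides over $Ac$ for some tuple $c$; a formula thorn-forks over $A$ if it implies a finite disjunction of formulas that thorn-divide over $A$; a type thorn-forks over $A$ if it implies a formula that does. $U^{\text{th}}$ is the foundation rank of thorn-forking: $U^{\text{th}}(p)\ge 0$ for every consistent complete type $p$; $U^{\text{th}}(p)\ge\lambda$ for limit $\lambda$ iff it is $\ge\alpha$ for all $\alpha<\lambda$; and for $p$ over $A$, $U^{\text{th}}(p)\ge\alpha+1$ iff $p$ has an extension $q$ that thorn-forks over $A$ with $U^{\text{th}}(q)\ge\alpha$. Write $U^{\text{th}}(a/A)=U^{\text{th}}(tp(a/A))$ and $U^{\text{th}}(a)=U^{\text{th}}(a/\emptyset)$. Global $U^{\text{th}}$-rank $1$ means that the supremum of $U^{\text{th}}(a)$ over single home-sort elements $a$ is $1$. A theory $T$ is thorn-minimal if for any model $N\models T$, any $a\in N^1$ with $a\notin acl(\emptyset)$, and any $A\subseteq N$, $tp(a/A)$ thorn-forks over $\emptyset$ if and only if $a$ is algebraic over $A$.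
   Formalization: The formal theorem assumes that M is infinite; for finite M every element is algebraic over the empty set, so the global U^th-rank is 0 and the claim of rank 1 fails. *)

(* Defs.v *)
From mathcomp Require Import all_boot.
From mathcomp Require Import boolp classical_sets functions cardinality.

Set Implicit Arguments.
Unset Strict Implicit.
Unset Printing Implicit Defensive.

Local Open Scope classical_set_scope.
Local Open Scope card_scope.

(** * Many-sorted first-order logic *)

Record language := Language {
  sort : Type;
  fsym : Type;
  far : fsym -> nat;
  fdom : forall f : fsym, 'I_(far f) -> sort;
  fcod : fsym -> sort;
  rsym : Type;
  rar : rsym -> nat;
  rdom : forall r : rsym, 'I_(rar r) -> sort }.

Record structure (L : language) := Structure {
  carrier :> sort L -> Type;
  fint : forall f : fsym L,
    (forall i, carrier (@fdom L f i)) -> carrier (fcod f);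
  rint : forall r : rsym L, (forall i, carrier (@rdom L r i)) -> Prop }.

(* A variable context is a type [X] of variables with their sorts
   [ctx : X -> sort L]; a quantifier adds the variable [None] to it. *)
Inductive term (L : language) (X : Type) (ctx : X -> sort L) : sort L -> Type :=
| Var (x : X) : term ctx (ctx x)
| App (f : fsym L) (args : forall i, term ctx (@fdom L f i)) :
    term ctx (fcod f).

Inductive formula (L : language) (X : Type) (ctx : X -> sort L) : Type :=
| Bot
| Eq (s : sort L) (t u : term ctx s)
| Rel (r : rsym L) (args : forall i, term ctx (@rdom L r i))
| Imp (phi psi : formula ctx)
| All (s : sort L) (phi : @formula L (option X) (oapp ctx s)).

(* An assignment of the variables of [ctx], i.e. a tuple of sort [ctx]. *)
Definition env (L : language) (S : structure L) (X : Type)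
  (ctx : X -> sort L) := forall x : X, S (ctx x).

Definition env_bind (L : language) (S : structure L) (X : Type)
    (ctx : X -> sort L) (s : sort L) (v : env S ctx) (b : S s) :
    env S (oapp ctx s) :=
  fun o => match o return S (oapp ctx s o) with Some x => v x | None => b end.

Fixpoint eval (L : language) (S : structure L) (X : Type) (ctx : X -> sort L)
    (v : env S ctx) (s : sort L) (t : term ctx s) : S s :=
  match t in term _ s return S s with
  | Var x => v x
  | App f args => fint (fun i => eval v (args i))
  end.

Fixpoint sat (L : language) (S : structure L) (X : Type) (ctx : X -> sort L)
    (v : env S ctx) (phi : formula ctx) : Prop :=
  match phi with
  | Bot => False
  | Eq s t u => eval v t = eval v u
  | Rel r args => rint (fun i => eval v (args i))
  | Imp phi psi => sat v phi -> sat v psi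
  | All s phi => forall b : S s, sat (env_bind v b) phi
  end.

(** * Theories *)

Definition sentence (L : language) := @formula L void (@of_void (sort L)).

Definition holds (L : language) (S : structure L) (phi : sentence L) : Prop :=
  sat (fun x : void => match x return S (of_void (sort L) x) with end) phi.

Definition Th (L : language) (S : structure L) : set (sentence L) :=
  [set phi | holds S phi].

Definition models (L : language) (S : structure L) (T : set (sentence L)) :=
  T `<=` Th S.

(** * Formulas with parameters, types, algebraic and definable closure *)

(* An element of [S], of any sort. *)
Definition elt (L : language) (S : structure L) := {s : sort L & S s}.

Definition on_sort (L : language) (S : structure L) (s : sort L)
  (A : set (S s)) : set (elt S) := [set Tagged S a | a in A].

(* The formula [pform] in the variables of [ctx] and [par] further variables,
   together with the finite tuple of elements assigned to the latter. *)
Record pformula (L : language) (S : structure L) (X : Type)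
    (ctx : X -> sort L) := PFormula {
  par : nat;
  psort : 'I_par -> sort L;
  pform : @formula L (X + 'I_par)
            (fun z => match z with inl x => ctx x | inr i => psort i end);
  pval : env S psort }.

Arguments psort {L S X ctx} p i.
Arguments pform {L S X ctx} p.
Arguments pval {L S X ctx} p x.

Definition env_sum (L : language) (S : structure L) (X Y : Type)
    (ctx : X -> sort L) (ctx' : Y -> sort L)
    (v : env S ctx) (w : env S ctx') :
    env S (fun z : X + Y =>
             match z with inl x => ctx x | inr y => ctx' y end) :=
  fun z => match z return
             S (match z with inl x => ctx x | inr y => ctx' y end) with
           | inl x => v x
           | inr y => w y
           end.

Definition params (L : language) (S : structure L) (X : Type)
    (ctx : X -> sort L) (phi : pformula S ctx) : set (elt S) :=
  [set Tagged S (pval phi i) | i in [set: 'I_(par phi)]].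

Definition psat (L : language) (S : structure L) (X : Type)
    (ctx : X -> sort L) (v : env S ctx) (phi : pformula S ctx) : Prop :=
  sat (env_sum v (pval phi)) (pform phi).

Definition realizes (L : language) (S : structure L) (X : Type)
    (ctx : X -> sort L) (p : set (pformula S ctx)) (v : env S ctx) : Prop :=
  forall phi, p phi -> psat v phi.

Definition tp (L : language) (S : structure L) (A : set (elt S)) (X : Type)
    (ctx : X -> sort L) (v : env S ctx) : set (pformula S ctx) :=
  [set phi | params phi `<=` A /\ psat v phi].

(* [tp(v/A)] has finitely many realizations in [S]. *)
Definition algebraic (L : language) (S : structure L) (A : set (elt S))
    (X : Type) (ctx : X -> sort L) (v : env S ctx) : Prop :=
  finite_set [set w : env S ctx | realizes (tp A v) w].

Definition single (L : language) (S : structure L) (s : sort L) (b : S s) :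
  env S (fun _ : unit => s) := fun _ => b.

Definition acl (L : language) (S : structure L) (A : set (elt S)) :
    set (elt S) :=
  [set e | algebraic A (single (tagged e))].

Definition dcl (L : language) (S : structure L) (A : set (elt S)) :
    set (elt S) :=
  [set e | forall w, realizes (tp A (single (tagged e))) w ->
           w = single (tagged e)].

(** * Saturation and homogeneity *)

Definition small (lam : Type) (L : language) (S : structure L)
  (A : set (elt S)) : Prop := A #<= [set: lam].

(* [|lam|^+]-saturation. *)
Definition saturated (lam : Type) (L : language) (S : structure L) : Prop :=
  forall (A : set (elt S)) (s : sort L)
         (p : set (pformula S (fun _ : unit => s))),
    small lam A ->
    (forall phi, p phi -> params phi `<=` A) ->
    (forall q, q `<=` p -> finite_set q -> exists b, realizes q b) ->
    exists b, realizes p b.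

Definition automorphism (L : language) (S : structure L)
    (g : forall s, S s -> S s) : Prop :=
  [/\ forall s, bijective (g s),
      forall (f : fsym L) (v : forall i, S (@fdom L f i)),
        g _ (fint v) = fint (fun i => g _ (v i)) &
      forall (r : rsym L) (v : forall i, S (@rdom L r i)),
        rint (fun i => g _ (v i)) <-> rint v].

(* Strong [|lam|^+]-homogeneity: every partial elementary map with small
   domain [A] extends to an automorphism. *)
Definition strongly_homogeneous (lam : Type) (L : language)
    (S : structure L) : Prop :=
  forall (A : set (elt S)) (h : forall s, S s -> S s),
    small lam A ->
    (forall n (ctx : 'I_n -> sort L) (phi : formula ctx) (v : env S ctx),
       (forall i, A (Tagged S (v i))) ->
       (sat v phi <-> sat (fun i => h _ (v i)) phi)) ->
    exists g, automorphism g /\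
      (forall s (a : S s), A (Tagged S a) -> g s a = h s a).

(** * One-sorted structures and monster models *)

Record signature := Signature {
  sg_fun : Type;
  sg_far : sg_fun -> nat;
  sg_rel : Type;
  sg_rar : sg_rel -> nat }.

Definition home_lang (Sg : signature) : language :=
  @Language unit (sg_fun Sg) (@sg_far Sg) (fun _ _ => tt) (fun _ => tt)
    (sg_rel Sg) (@sg_rar Sg) (fun _ _ => tt).

Definition hstruct (Sg : signature) := structure (home_lang Sg).

Definition home (Sg : signature) (M : hstruct Sg) : Type := M tt.

Definition hctx (Sg : signature) (X : Type) : X -> sort (home_lang Sg) :=
  fun _ => tt.

Definition elementary (Sg : signature) (M C : hstruct Sg)
    (j : home M -> home C) : Prop :=
  forall n (phi : formula (@hctx Sg 'I_n)) (v : 'I_n -> home M),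
    @sat _ M _ _ v phi <-> @sat _ C _ _ (fun i => j (v i)) phi.

(* A type of cardinality [|L| + aleph_0 + |M|]: the sum of the set of formulas
   in countably many variables and of [M]. *)
Definition bound (Sg : signature) (M : hstruct Sg) : Type :=
  (formula (@hctx Sg nat) + home M)%type.

(* [C] is a monster model containing [M] (via [j]): it is kappa-saturated and
   strongly kappa-homogeneous for some kappa > |L| + aleph_0 + |M|, which
   amounts to the case kappa = (|L| + aleph_0 + |M|)^+. *)
Definition monster (Sg : signature) (M C : hstruct Sg)
    (j : home M -> home C) : Prop :=
  [/\ elementary j, saturated (bound M) C &
      strongly_homogeneous (bound M) C].

Definition hacl (Sg : signature) (C : hstruct Sg) (A : set (home C)) :
    set (home C) :=
  [set b | acl (on_sort (A : set (C tt))) (@Tagged unit tt C b)].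

(** * Imaginaries *)

Definition defrel (Sg : signature) (C : hstruct Sg) (n : nat)
    (phi : formula (@hctx Sg ('I_n + 'I_n))) (a b : 'I_n -> home C) : Prop :=
  @sat _ C _ _ (fun z => match z with inl i => a i | inr i => b i end) phi.

Record eqrel (Sg : signature) (C : hstruct Sg) := EqRel {
  eq_ar : nat;
  eq_form : formula (@hctx Sg ('I_eq_ar + 'I_eq_ar));
  eq_form_refl : forall a, @defrel Sg C eq_ar eq_form a a;
  eq_form_sym : forall a b,
    @defrel Sg C eq_ar eq_form a b -> defrel eq_form b a;
  eq_form_trans : forall a b c,
    @defrel Sg C eq_ar eq_form a b -> defrel eq_form b c ->
    defrel eq_form a c }.

(* The home sort is [None]; each 0-definable equivalence relation [E] on
   [eq_ar E]-tuples adds a sort [Some E] and a function symbol [inr E] for the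
   projection onto the classes of [E]. *)
Definition eq_lang (Sg : signature) (C : hstruct Sg) : language :=
  @Language (option (eqrel C))
    (sg_fun Sg + eqrel C)
    (fun f => match f with inl f => sg_far f | inr E => eq_ar E end)
    (fun _ _ => None)
    (fun f => match f with inl _ => None | inr E => Some E end)
    (sg_rel Sg) (@sg_rar Sg) (fun _ _ => None).

Definition eq_class (Sg : signature) (C : hstruct Sg) (E : eqrel C) : Type :=
  {K : set ('I_(eq_ar E) -> home C) |
    exists a, K = [set b | defrel (eq_form E) a b]}.

Definition eq_carrier (Sg : signature) (C : hstruct Sg)
    (s : option (eqrel C)) : Type :=
  match s with None => home C | Some E => eq_class E end.

Definition eq_proj (Sg : signature) (C : hstruct Sg) (E : eqrel C)
    (a : 'I_(eq_ar E) -> home C) : eq_class E :=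
  exist _ [set b | defrel (eq_form E) a b] (ex_intro _ a erefl).

(* The structure C^eq. *)
Definition Ceq (Sg : signature) (C : hstruct Sg) : structure (eq_lang C) :=
  @Structure (eq_lang C) (@eq_carrier Sg C)
    (fun f => match f return
        (forall i, eq_carrier (@fdom (eq_lang C) f i)) ->
        eq_carrier (@fcod (eq_lang C) f) with
      | inl f => fun v => @fint (home_lang Sg) C f v
      | inr E => fun v => @eq_proj Sg C E v
      end)
    (fun r v => @rint (home_lang Sg) C r v).

Definition in_eq (Sg : signature) (C : hstruct Sg) (A : set (home C)) :
    set (elt (Ceq C)) :=
  @on_sort (eq_lang C) (Ceq C) None A.

(* The tuple [a] of elements of the home sort, seen as a tuple of C^eq. *)
Definition eq_ctx (Sg : signature) (C : hstruct Sg) (X : Type) :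
  X -> sort (eq_lang C) := fun _ => None.

Definition eq_env (Sg : signature) (C : hstruct Sg) (X : Type)
  (a : X -> home C) : env (Ceq C) (@eq_ctx Sg C X) := a.

(** * Thorn-forking *)

Definition strongly_divides (L : language) (S : structure L)
    (A : set (elt S)) (X : Type) (ctx : X -> sort L)
    (delta : pformula S ctx) : Prop :=
  ~ algebraic A (pval delta) /\
  exists k : nat, forall w : 'I_k -> env S (psort delta),
    injective w ->
    (forall i, realizes (tp A (pval delta)) (w i)) ->
    ~ exists v : env S ctx, forall i, psat v (PFormula (pform delta) (w i)).

Definition thorn_divides (L : language) (S : structure L)
    (A : set (elt S)) (X : Type) (ctx : X -> sort L)
    (delta : pformula S ctx) : Prop :=
  exists (m : nat) (c : 'I_m -> elt S), strongly_divides (A `|` range c) delta.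

Definition thorn_forks (L : language) (S : structure L)
    (A : set (elt S)) (X : Type) (ctx : X -> sort L)
    (phi : pformula S ctx) : Prop :=
  exists (m : nat) (delta : 'I_m -> pformula S ctx),
    (forall i, thorn_divides A (delta i)) /\
    (forall v : env S ctx, psat v phi -> exists i, psat v (delta i)).

Definition type_thorn_forks (L : language) (S : structure L)
    (A : set (elt S)) (X : Type) (ctx : X -> sort L)
    (p : set (pformula S ctx)) : Prop :=
  exists phi : pformula S ctx,
    (forall v, realizes p v -> psat v phi) /\ thorn_forks A phi.

(** * The rank U^thorn *)

Record well_order := WellOrder {
  wo_car :> Type;
  wo_lt : wo_car -> wo_car -> Prop;
  wo_wf : well_founded wo_lt;
  wo_trans : forall u v w, wo_lt u v -> wo_lt v w -> wo_lt u w;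
  wo_total : forall u v, [\/ wo_lt u v, u = v | wo_lt v u] }.

Definition wo_zero (W : well_order) (w : W) : Prop := forall u, ~ wo_lt u w.

Definition wo_succ (W : well_order) (v w : W) : Prop :=
  wo_lt v w /\ forall u, wo_lt u w -> wo_lt u v \/ u = v.

Definition wo_limit (W : well_order) (w : W) : Prop :=
  ~ wo_zero w /\ forall v, ~ wo_succ v w.

(* Complete types over small sets are the types of tuples of the ambient
   monster model. *)
Definition complete_type (L : language) (S : structure L)
    (A : set (elt S)) (X : Type) (ctx : X -> sort L)
    (p : set (pformula S ctx)) : Prop :=
  exists v : env S ctx, p = tp A v.

(* [Uth_ge lam w A p]: for the type [p] over [A], U^thorn(p) >= alpha, where
   alpha is the ordinal represented by the position of [w] in the well-order
   [W]; types are over sets of cardinality at most [|lam|]. *)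
Inductive Uth_ge (lam : Type) (L : language) (S : structure L) (X : Type)
    (ctx : X -> sort L) (W : well_order) :
    W -> set (elt S) -> set (pformula S ctx) -> Prop :=
| Uth_zero w A p : wo_zero w -> complete_type A p -> Uth_ge lam w A p
| Uth_limit w A p : wo_limit w ->
    (forall v, wo_lt v w -> Uth_ge lam v A p) -> Uth_ge lam w A p
| Uth_succ v w A p B q : wo_succ v w -> complete_type A p ->
    A `<=` B -> small lam B -> complete_type B q -> p `<=` q ->
    type_thorn_forks A q -> Uth_ge lam v B q ->
    Uth_ge lam w A p.

Lemma nat_lt_wf : well_founded (fun m n : nat => m < n).
Proof.
by elim/ltn_ind=> n IHn; constructor=> k /IHn.
Qed.

Lemma nat_lt_trans (m n p : nat) : m < n -> n < p -> m < p.
Proof. exact: ltn_trans. Qed.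

Lemma nat_lt_total (m n : nat) : [\/ m < n, m = n | n < m].
Proof.
by have [lt_mn|lt_nm|->] := ltngtP m n;
  [constructor 1 | constructor 3 | constructor 2].
Qed.

Definition omega : well_order := WellOrder nat_lt_wf nat_lt_trans nat_lt_total.

(* U^thorn(a/A) >= n for a tuple [a] of C^eq and a natural number [n]. *)
Definition Uth_ge_nat (lam : Type) (L : language) (S : structure L)
    (A : set (elt S)) (X : Type) (ctx : X -> sort L) (a : env S ctx)
    (n : nat) : Prop :=
  @Uth_ge lam L S X ctx omega n A (tp A a).

Definition Uth_le_nat (lam : Type) (L : language) (S : structure L)
    (A : set (elt S)) (X : Type) (ctx : X -> sort L) (a : env S ctx)
    (n : nat) : Prop :=
  ~ Uth_ge_nat lam A a n.+1.

Definition Uth_eq_nat (lam : Type) (L : language) (S : structure L)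
    (A : set (elt S)) (X : Type) (ctx : X -> sort L) (a : env S ctx)
    (n : nat) : Prop :=
  Uth_ge_nat lam A a n /\ Uth_le_nat lam A a n.

(* The supremum of U^thorn(a) over the elements [a] of the home sort is [n]. *)
Definition global_Uth_rank (lam : Type) (Sg : signature) (C : hstruct Sg)
    (n : nat) : Prop :=
  (forall a : home C, Uth_le_nat lam set0 (eq_env (fun _ : unit => a)) n) /\
  (forall m : nat,
     (forall a : home C, Uth_le_nat lam set0 (eq_env (fun _ : unit => a)) m) ->
     n <= m).

(** * The hypotheses and conclusions *)

Definition weakly_omega_saturated (Sg : signature) (M C : hstruct Sg)
    (j : home M -> home C) : Prop :=
  forall (c : home M) (n : nat) (phi : formula (@hctx Sg ('I_n + unit))),
    (exists a : 'I_n -> home C,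
       @sat _ C _ _ (fun z => match z with inl i => a i | inr _ => j c end) phi
       /\ forall i : 'I_n,
            ~ hacl (a @` [set k : 'I_n | i < k] `|` [set j c]) (a i)) ->
    exists b : 'I_n -> home M,
       @sat _ M _ _ (fun z => match z with inl i => b i | inr _ => c end) phi
       /\ forall i : 'I_n,
            ~ hacl (b @` [set k : 'I_n | i < k] `|` [set c]) (b i).

(* The exchange property for elements and subsets of [M], with algebraic
   closure computed in the monster model [C]. *)
Definition exchange (Sg : signature) (M C : hstruct Sg)
    (j : home M -> home C) : Prop :=
  forall (a b : home M) (A : set (home M)),
    hacl (j @` (A `|` [set b])) (j a) -> ~ hacl (j @` A) (j a) ->
    hacl (j @` (A `|` [set a])) (j b).

Definition geometric_EI (Sg : signature) (T : set (sentence (home_lang Sg))) :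
    Prop :=
  forall (N C : hstruct Sg) (j : home N -> home C),
    models N T -> monster j ->
    forall e : elt (Ceq C), dcl (in_eq (range j)) e ->
    exists x : set (home N), finite_set x /\
      acl [set e] = acl (in_eq (j @` x)).

Definition weak_EI (Sg : signature) (M : hstruct Sg) : Prop :=
  geometric_EI (Th M).

Definition thorn_minimal (Sg : signature) (T : set (sentence (home_lang Sg))) :
    Prop :=
  forall (N C : hstruct Sg) (j : home N -> home C),
    models N T -> monster j ->
    forall (a : home N) (A : set (home N)),
      ~ hacl set0 (j a) ->
      (type_thorn_forks set0
         (tp (in_eq (j @` A)) (eq_env (fun _ : unit => j a)))
       <-> hacl (j @` A) (j a)).

Definition alg_independent (Sg : signature) (C : hstruct Sg)
    (B : set (home C)) : Prop :=
  forall b, B b -> ~ hacl (B `\ b) b.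

(* [d] is the cardinality of a maximal algebraically independent subset
   of [A]. *)
Definition dim_alg (Sg : signature) (C : hstruct Sg) (A : set (home C))
    (d : nat) : Prop :=
  exists B : set (home C),
    [/\ B `<=` A, alg_independent B,
        forall B', B `<=` B' -> B' `<=` A -> alg_independent B' -> B' = B &
        B #= `I_d].

(* Main.v *)
Require Import Defs.
From mathcomp Require Import all_boot.
From mathcomp Require Import boolp classical_sets functions cardinality.
Import Defs.

Set Implicit Arguments.
Unset Strict Implicit.
Unset Printing Implicit Defensive.

Local Open Scope classical_set_scope.
Local Open Scope card_scope.

(* Exchange passes from [M] to every monster model [C'] of [Th M]: a failure is
   a formula satisfied by a tuple free in the sense of weak saturation, and such
   a tuple is copied into the monster model of [M], independently of the
   parameter [c], and then into [M]. By geometric elimination of imaginaries,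
   algebraic closure over imaginary parameters is algebraic closure over finite
   sets of home elements, so exchange also holds over subsets of [C'^eq].

   Adding the entries of a tuple [u] to [A] from the last one to the first, call
   an entry a jump if it is not algebraic over [A] and the entries after it. If
   the type of [u] over [B] thorn-forks over a subset [A] of [B], some jump over
   [A] is not a jump over [B]. Hence U^thorn(u/A) is at most the number of jumps;
   for the empty [A] and [u] ordered with a basis at the end this number is the
   dimension. Conversely, adding the elements [b] of a basis one by one gives a
   chain of forking extensions, since [x = b] strongly divides when [b] is not
   algebraic. *)

(** The hypotheses speak of [M], of one parameter and of one formula at a time, while the
    conclusions concern arbitrary monster models and their imaginaries. Three gaps shape the proof.
    Weak saturation copies a tuple for a single formula, so algebraicity has to be witnessed by one
    formula that also bounds the number of its solutions. This is the notion [alg_over], whereas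
    [acl] counts the realizations of a whole type. Both agree over small sets in a saturated
    structure, which is why cardinal arithmetic and the saturation of [Ceq C] are needed.
    Elimination of imaginaries is given only for imaginaries definable over a model inside its
    monster model. An arbitrary imaginary is definable over the Skolem hull of a representative, and
    the ambient structure is a monster model of this hull too, because [bound] does not grow.
    Thorn-forking involves finitely many dividing formulas with arbitrary extra parameters, and
    which formula holds depends on the realization. All these parameters are therefore put in one
    finite set, and the type is realized freely from it before a formula is selected. *)

Local Notation sctx cX cY :=
  (fun z => match z with inl x => cX x | inr y => cY y end).

(** * Substitution and definable relations *)

Fixpoint tsubst (L : language) (X Y : Type) (cX : X -> sort L)
    (cY : Y -> sort L) (f : forall x, term cY (cX x)) (s : sort L)
    (t : term cX s) : term cY s :=
  match t in term _ s return term cY s with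
  | Var x => f x
  | App g args => App (fun i => tsubst f (args i))
  end.

Definition tlift (L : language) (X Y : Type) (cX : X -> sort L)
    (cY : Y -> sort L) (f : forall x, term cY (cX x)) (s : sort L) (o : option X) :
    term (oapp cY s) (oapp cX s o) :=
  match o return term (oapp cY s) (oapp cX s o) with
  | Some x => tsubst (cY := oapp cY s) (fun y => Var (oapp cY s) (Some y)) (f x)
  | None => Var (oapp cY s) None
  end.

Fixpoint fsubst (L : language) (X : Type) (cX : X -> sort L)
    (phi : formula cX) (Y : Type) (cY : Y -> sort L)
    (f : forall x, term cY (cX x)) : formula cY :=
  match phi with
  | Bot => Bot cY
  | Eq s t u => Eq (tsubst f t) (tsubst f u)
  | Rel r args => Rel (fun i => tsubst f (args i))
  | Imp phi psi => Imp (fsubst phi f) (fsubst psi f)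
  | All s phi => All (fsubst phi (tlift f s))
  end.

Lemma eval_tsubst (L : language) (S : structure L) (X Y : Type)
    (cX : X -> sort L) (cY : Y -> sort L) (f : forall x, term cY (cX x))
    (v : env S cY) (s : sort L) (t : term cX s) :
  eval v (tsubst f t) = eval (fun x => eval v (f x) : S (cX x)) t.
Proof.
elim: t => [//|g args IH] /=; congr fint.
by apply: functional_extensionality_dep => i; apply: IH.
Qed.

Lemma eval_tlift (L : language) (S : structure L) (X Y : Type)
    (cX : X -> sort L) (cY : Y -> sort L) (f : forall x, term cY (cX x))
    (s : sort L) (v : env S cY) (b : S s) :
  (fun o => eval (env_bind v b) (tlift f s o)) =
  env_bind (fun x => eval v (f x) : S (cX x)) b.
Proof.
by apply: functional_extensionality_dep => -[x|] //=; rewrite eval_tsubst.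
Qed.

Lemma sat_fsubst (L : language) (S : structure L) (X : Type)
    (cX : X -> sort L) (phi : formula cX) (Y : Type) (cY : Y -> sort L)
    (f : forall x, term cY (cX x)) (v : env S cY) :
  sat v (fsubst phi f) <-> sat (fun x => eval v (f x) : S (cX x)) phi.
Proof.
elim: phi Y cY f v => {X cX} [X cX|X cX s t u|X cX r args|X cX p IHp q IHq|X cX s p IH]
  Y cY f v //=.
- by rewrite !eval_tsubst.
- suff -> : (fun i => eval v (tsubst f (args i))) =
    (fun i => eval (fun x => eval v (f x) : S (cX x)) (args i)) by [].
  by apply: functional_extensionality_dep => i; rewrite eval_tsubst.
- by rewrite IHp IHq.
- by split=> H b; move: (H b); rewrite IH eval_tlift.
Qed.

(* Definability is uniform over a family [St] of structures: a single
   structure, or all of them when a formula must be moved between models. *)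
Section Definability.
Variables (L : language) (I : Type) (St : I -> structure L).

Definition fodef (X : Type) (ctx : X -> sort L)
    (R : forall i, env (St i) ctx -> Prop) : Prop :=
  exists phi : formula ctx, forall i v, sat v phi <-> R i v.

Definition tmdef (X : Type) (ctx : X -> sort L) (s : sort L)
    (F : forall i, env (St i) ctx -> St i s) : Prop :=
  exists t : term ctx s, forall i v, eval v t = F i v.

Variables (X : Type) (ctx : X -> sort L).
Implicit Types R Q : forall i, env (St i) ctx -> Prop.

Lemma fodef_ext R Q : (forall i v, Q i v <-> R i v) -> fodef R -> fodef Q.
Proof. by move=> RQ [phi H]; exists phi => i v; rewrite RQ H. Qed.

Lemma fodef_false : fodef (fun i (_ : env (St i) ctx) => False).
Proof. by exists (Bot ctx). Qed.

Lemma fodef_imp R Q : fodef R -> fodef Q -> fodef (fun i v => R i v -> Q i v).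
Proof. by move=> [p P] [q H]; exists (Imp p q) => i v /=; rewrite P H. Qed.

Lemma fodef_not R : fodef R -> fodef (fun i v => ~ R i v).
Proof. by move=> H; exact: fodef_imp H fodef_false. Qed.

Lemma fodef_and R Q : fodef R -> fodef Q -> fodef (fun i v => R i v /\ Q i v).
Proof.
move=> dR dQ; apply: fodef_ext (fodef_not (fodef_imp dR (fodef_not dQ))).
move=> i v; split=> [[r q] H|H]; first exact: H r q.
by split; apply: contrapT => N; apply: H => r // q; apply: N.
Qed.

Lemma fodef_all (s : sort L) (R : forall i, env (St i) ctx -> St i s -> Prop) :
  @fodef (option X) (oapp ctx s)
    (fun i w => R i (fun x => w (Some x)) (w None)) ->
  fodef (fun i v => forall b, R i v b).
Proof.
by move=> [p P]; exists (All p) => i v /=; split=> H b; move: (H b); rewrite P.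
Qed.

Lemma fodef_ex (s : sort L) (R : forall i, env (St i) ctx -> St i s -> Prop) :
  @fodef (option X) (oapp ctx s)
    (fun i w => R i (fun x => w (Some x)) (w None)) ->
  fodef (fun i v => exists b, R i v b).
Proof.
move=> [p P]; exists (Imp (All (Imp p (Bot _))) (Bot _)) => i v /=; split.
- move=> H; apply: contrapT => N; apply: H => b; rewrite P => r.
  by apply: N; exists b.
- by move=> [b r] H; apply: (H b); rewrite P.
Qed.

Lemma fodef_alln n (R : 'I_n -> forall i, env (St i) ctx -> Prop) :
  (forall k, fodef (R k)) -> fodef (fun i v => forall k, R k i v).
Proof.
elim: n R => [|n IH] R dR.
  by exists (Imp (Bot _) (Bot _)) => i v; split=> // _ [].
apply: fodef_ext (fodef_and (dR ord0) (IH (fun k => R (lift ord0 k)) _)) => //.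
move=> i v; split=> [H//|[H0 H] k].
by case: (unliftP ord0 k) => [j|] ->.
Qed.

Lemma fodef_exon n (R : 'I_n -> forall i, env (St i) ctx -> Prop) :
  (forall k, fodef (R k)) -> fodef (fun i v => exists k, R k i v).
Proof.
move=> dR; apply: fodef_ext (fodef_not (fodef_alln (fun k => fodef_not (dR k)))).
move=> i v; split=> [[k r] H|H]; first exact: H k r.
by apply: contrapT => N; apply: H => k r; apply: N; exists k.
Qed.

Lemma tmdef_var (x : X) : tmdef (fun i (v : env (St i) ctx) => v x).
Proof. by exists (Var ctx x). Qed.

Lemma fodef_eq s (F G : forall i, env (St i) ctx -> St i s) :
  tmdef F -> tmdef G -> fodef (fun i v => F i v = G i v).
Proof. by move=> [t T] [u U]; exists (Eq t u) => i v /=; rewrite T U. Qed.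

Lemma fodef_rel (r : rsym L)
    (F : forall k i, env (St i) ctx -> St i (@rdom L r k)) :
  (forall k, tmdef (F k)) -> fodef (fun i v => rint (fun k => F k i v)).
Proof.
move=> /(_ _)/cid H; exists (Rel (fun k => sval (H k))) => i v /=.
suff -> : (fun k => eval v (sval (H k))) = (fun k => F k i v) by [].
by apply: functional_extensionality_dep => k; case: (H k).
Qed.

Lemma fodef_subst (Y : Type) (cY : Y -> sort L)
    (R : forall i, env (St i) ctx -> Prop)
    (E : forall i, env (St i) cY -> env (St i) ctx) :
  fodef R -> (forall x, tmdef (fun i v => E i v x)) ->
  fodef (fun i v => R i (E i v)).
Proof.
move=> [p P] /(_ _)/cid H; exists (fsubst p (fun x => sval (H x))) => i v.
rewrite sat_fsubst P.
suff -> : (fun x => eval v (sval (H x))) = E i v by [].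
by apply: functional_extensionality_dep => x; case: (H x).
Qed.

Lemma fodef_sat (Y : Type) (cY : Y -> sort L) (phi : formula ctx)
    (E : forall i, env (St i) cY -> env (St i) ctx) :
  (forall x, tmdef (fun i v => E i v x)) ->
  fodef (fun i v => sat (E i v) phi).
Proof. by move=> H; apply: (@fodef_subst _ _ (fun i v => sat v phi) E _ H); exists phi. Qed.

End Definability.

(** One coordinate is quantified at a time, coordinate 0 outermost. The sorts depend on the
    coordinate, so gluing a head and a tail into a tuple ([w2]) goes through a case analysis with
    transport. *)
Lemma fodef_exn (L : language) (I : Type) (St : I -> structure L) n :
  forall (c : 'I_n -> sort L) (X : Type) (ctx : X -> sort L)
    (R : forall i, env (St i) ctx -> env (St i) c -> Prop),
  @fodef L I St (X + 'I_n)
    (fun z => match z with inl x => ctx x | inr k => c k end)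
    (fun i w => R i (fun x => w (inl x)) (fun k => w (inr k))) ->
  fodef (fun i v => exists w, R i v w).
Proof.
elim: n => [|n IH] c X ctx R dR.
  have e0 i (v w : env (St i) c) : v = w.
    by apply: functional_extensionality_dep => -[].
  have d0 : forall i, env (St i) c by move=> i [].
  apply: (@fodef_ext _ _ _ _ _ (fun i v => R i v (d0 i))).
    move=> i v; split=> [[w]|r]; last by exists (d0 i).
    by rewrite (e0 _ w (d0 i)).
  have := @fodef_subst _ _ _ _ _ _ _ _ (fun i v =>
    env_sum v (d0 i)) dR; apply.
  by case=> [x|[]//]; apply: tmdef_var.
set c' := fun k => c (lift ord0 k).
(* The variable standing for coordinate [k] has sort [c k] only after it is known whether [k] is the
   head, so it is chosen as a term together with its value. *)
have /(_ _)/cid tm : forall k : 'I_n.+1, exists t : term (fun z : option X + 'I_n =>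
     match z with inl x => oapp ctx (c ord0) x | inr k => c' k end) (c k),
   forall i (v : env (St i) ctx) (w : env (St i) c),
     eval (env_sum (env_bind v (w ord0)) (fun k => w (lift ord0 k))) t = w k.
  move=> k; case: (unliftP ord0 k) => [j ->|->].
    by exists (Var (fun z : option X + 'I_n =>
     match z with inl x => oapp ctx (c ord0) x | inr k => c' k end) (inr j)).
  by exists (Var (fun z : option X + 'I_n =>
     match z with inl x => oapp ctx (c ord0) x | inr k => c' k end) (inl None)).
have @w2 i (b : St i (c ord0)) (w' : env (St i) c') : env (St i) c.
  move=> k; case: (unliftP ord0 k) => [j ->|->]; [exact: w' j|exact: b].
have w2_0 i b w' : @w2 i b w' ord0 = b.
  rewrite /w2; case: unliftP => [j e|e]; first by case/eqP: (neq_lift ord0 j).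
  by rewrite (eq_irrelevance e erefl).
have w2_S i b w' j : @w2 i b w' (lift ord0 j) = w' j.
  rewrite /w2; case: unliftP => [j' e|e]; last by have /eqP[] := neq_lift ord0 j.
  have ej : j = j' by apply: lift_inj e.
  by subst j'; rewrite (eq_irrelevance e erefl).
have w2E i (w : env (St i) c) : w2 i (w ord0) (fun k => w (lift ord0 k)) = w.
  apply: functional_extensionality_dep => k.
  by case: (unliftP ord0 k) => [j ->|->]; rewrite ?w2_S ?w2_0.
apply: (@fodef_ext _ _ _ _ _ (fun i v => exists b w', R i v (w2 i b w'))).
  move=> i v; split=> [[w r]|[b [w' r]]]; last by exists (w2 i b w').
  by exists (w ord0), (fun k => w (lift ord0 k)); rewrite w2E.
apply: fodef_ex; apply: IH.
have := @fodef_subst _ _ _ _ _ _ _ _ (fun i (v : env (St i)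
     (fun z : option X + 'I_n =>
     match z with inl x => oapp ctx (c ord0) x | inr k => c' k end)) =>
   env_sum (fun x => v (inl (Some x)))
     (w2 i (v (inl None)) (fun k => v (inr k)))) dR; apply.
case=> [x|k]; first by exists (Var _ (inl (Some x))).
exists (sval (tm k)) => i v /=; case: (tm k) => t /= T.
rewrite -(T i (fun x => v (inl (Some x)))) w2_0.
suff -> : env_sum (env_bind (fun x => v (inl (Some x))) (v (inl None)))
   (fun j => w2 i (v (inl None)) (fun k0 => v (inr k0)) (lift ord0 j)) = v by [].
apply: functional_extensionality_dep => -[[x|]|j] //=.
exact: w2_S.
Qed.

(** * Finite support and types *)

Definition tm_on (L : language) (Z : Type) (c : Z -> sort L) (F : set Z)
    (s : sort L) (t : term c s) : Prop :=
  exists t' : term (fun z : {z | F z} => c (sval z)) s,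
    forall (S : structure L) (v : env S c),
      eval (fun z => v (sval z) : S (c (sval z))) t' = eval v t.

Definition fm_on (L : language) (Z : Type) (c : Z -> sort L) (F : set Z)
    (phi : formula c) : Prop :=
  exists phi' : formula (fun z : {z | F z} => c (sval z)),
    forall (S : structure L) (v : env S c),
      sat (fun z => v (sval z) : S (c (sval z))) phi' <-> sat v phi.

Definition inclv (L : language) (Z : Type) (c : Z -> sort L) (F G : set Z)
    (FG : F `<=` G) (z : {z | F z}) :
    term (fun z : {z | G z} => c (sval z)) (c (sval z)) :=
  Var (fun z : {z | G z} => c (sval z)) (exist G (sval z) (FG _ (proj2_sig z))).

Lemma tm_onS (L : language) (Z : Type) (c : Z -> sort L) (F G : set Z)
    (s : sort L) (t : term c s) :
  F `<=` G -> tm_on F t -> tm_on G t.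
Proof.
by move=> FG [t' T]; exists (tsubst (inclv c FG) t') => S v; rewrite eval_tsubst T.
Qed.

Lemma fm_onS (L : language) (Z : Type) (c : Z -> sort L) (F G : set Z)
    (phi : formula c) :
  F `<=` G -> fm_on F phi -> fm_on G phi.
Proof.
by move=> FG [t' T]; exists (fsubst t' (inclv c FG)) => S v; rewrite sat_fsubst T.
Qed.

Lemma tm_on_finite (L : language) (Z : Type) (c : Z -> sort L) (s : sort L)
    (t : term c s) : exists F : set Z, finite_set F /\ tm_on F t.
Proof.
elim: t => {s} [z|f args /(_ _)/cid IH].
  exists [set z]; split; first exact: finite_set1.
  by exists (Var (fun z' : {z' | [set z] z'} => c (sval z')) (exist _ z erefl)).
pose F := \bigcup_(i in [set: 'I_(far f)]) sval (IH i).
have FF : finite_set F.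
  by apply: bigcup_finite => [|i _]; [exact: finite_finset|case: (svalP (IH i))].
have /(_ _)/cid H i : tm_on F (args i).
  case: (svalP (IH i)) => _; apply: tm_onS => z Fz; by exists i.
exists F; split=> //; exists (App (fun i => sval (H i))) => S v /=.
congr fint; apply: functional_extensionality_dep => i.
exact: (svalP (H i)).
Qed.

(** Contexts may be infinite, because whole parameter sets serve as contexts below; a formula
    depends on finitely many variables, the same ones in every structure. *)
Lemma fm_on_finite (L : language) (Z : Type) (c : Z -> sort L)
    (phi : formula c) : exists F : set Z, finite_set F /\ fm_on F phi.
Proof.
elim: phi => {Z c} [Z c|Z c s t u|Z c r args
  |Z c p [F [fF [p' P]]] q [G [fG [q' Q]]]|Z c s p [F [fF [p' P]]]].
- by exists set0; split; [exact: finite_set0|exists (Bot _)].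
- have [F [fF tF]] := tm_on_finite t; have [G [fG uG]] := tm_on_finite u.
  exists (F `|` G); split; first by rewrite finite_setU.
  have [t' T] : tm_on (F `|` G) t by apply: tm_onS tF; exact: subsetUl.
  have [u' U] : tm_on (F `|` G) u by apply: tm_onS uG; exact: subsetUr.
  by exists (Eq t' u') => S v /=; rewrite T U.
- have /(_ _)/cid IH := fun i => tm_on_finite (args i).
  pose F := \bigcup_(i in [set: 'I_(rar r)]) sval (IH i).
  have FF : finite_set F.
    by apply: bigcup_finite => [|i _]; [exact: finite_finset|case: (svalP (IH i))].
  have /(_ _)/cid H i : tm_on F (args i).
    case: (svalP (IH i)) => _; apply: tm_onS => z Fz; by exists i.
  exists F; split=> //; exists (Rel (fun i => sval (H i))) => S v /=.
  suff -> : (fun i => eval (fun z => v (sval z)) (sval (H i))) =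
    (fun i => eval v (args i)) by [].
  apply: functional_extensionality_dep => i.
  exact: (svalP (H i)).
- exists (F `|` G); split; first by rewrite finite_setU.
  have [p2 P2] : fm_on (F `|` G) p.
    by apply: (fm_onS (@subsetUl _ F G)); exists p'.
  have [q2 Q2] : fm_on (F `|` G) q.
    by apply: (fm_onS (@subsetUr _ F G)); exists q'.
  by exists (Imp p2 q2) => S v /=; rewrite P2 Q2.
- exists (Some @^-1` F); split.
    by apply: finite_preimage => // x y _ _ [].
  pose G := Some @^-1` F.
  pose h (o : {o | F o}) : term (oapp (fun z : {z | G z} => c (sval z)) s)
      (oapp c s (sval o)) :=
    let: exist o Fo := o in
    match o return F o -> term (oapp (fun z : {z | G z} => c (sval z)) s) (oapp c s o) with
    | Some z => fun Fz => Var (oapp (fun z : {z | G z} => c (sval z)) s) (Some (exist G z Fz))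
    | None => fun _ => Var (oapp (fun z : {z | G z} => c (sval z)) s) None
    end Fo.
  exists (All (fsubst p' h)) => S v /=; split=> H b; move: (H b);
    rewrite sat_fsubst -P.
    suff -> : (fun x => eval (env_bind (fun z : {z | G z} => v (sval z) : S (c (sval z))) b) (h x)) =
      (fun z => env_bind v b (sval z)) by [].
    by apply: functional_extensionality_dep => -[[z|] Fz].
  suff -> : (fun x => eval (env_bind (fun z : {z | G z} => v (sval z) : S (c (sval z))) b) (h x)) =
      (fun z => env_bind v b (sval z)) by [].
  by apply: functional_extensionality_dep => -[[z|] Fz].
Qed.

Lemma finite_enum_inj (T : Type) (A : set T) n : A #= `I_n ->
  exists h : 'I_n -> T, injective h /\ range h = A.
Proof.
move=> An; have : [set: 'I_n] #= A.
  by rewrite card_eq_sym; apply: card_eq_trans An _; exact: card_II.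
move=> /card_bijP[f [g fg gf]]; exists (fun i => set_val (f (to_setT i))).
split=> [i k /val_inj /(can_inj fg)/(congr1 val)//|].
apply/seteqP; split=> [_ [i _ <-]|x Ax]; first exact: set_valP.
exists (set_val (g (SigSub (mem_set Ax)))) => //.
rewrite (_ : to_setT _ = g (SigSub (mem_set Ax))) ?gf //.
exact: val_inj.
Qed.

Lemma finite_enum (T : Type) (A : set T) :
  finite_set A -> exists n (h : 'I_n -> T), range h = A.
Proof. by move=> /finite_setP[n /finite_enum_inj[h [_ hA]]]; exists n, h. Qed.

(** Only the parameter side [Y] is cut down; this turns a formula naming all elements of a set into
    one that fits a [pformula]. *)
Lemma fm_params_finite (L : language) (X Y : Type) (cX : X -> sort L)
    (cY : Y -> sort L) (phi : formula (sctx cX cY)) :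
  exists n (h : 'I_n -> Y) (psi : formula (sctx cX (fun i => cY (h i)))),
    forall (S : structure L) (v : env S cX) (w : env S cY),
      sat (env_sum v w) phi <->
      sat (env_sum v (fun i => w (h i) : S (cY (h i)))) psi.
Proof.
have [F [fF [psi P]]] := fm_on_finite phi.
have [|n [h hE]] := @finite_enum _ (inr @^-1` F : set Y).
  by apply: finite_preimage => // x y _ _ [].
exists n, h.
have /(_ _)/cid H (z : {z | F z}) :
  exists t : term (sctx cX (fun i => cY (h i))) (sctx cX cY (sval z)),
    forall (S : structure L) (v : env S cX) (w : env S cY),
    eval (env_sum v (fun i => w (h i) : S (cY (h i)))) t = env_sum v w (sval z).
  case: z => -[x|y] Fz /=; first by exists (Var (sctx cX (fun i => cY (h i))) (inl x)).
  have : (inr @^-1` F) y by [].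
  rewrite -hE => -[i _ hi]; move: Fz; rewrite -hi => Fz.
  by exists (Var (sctx cX (fun i => cY (h i))) (inr i)).
exists (fsubst psi (fun z => sval (H z))) => S v w.
rewrite sat_fsubst -P.
suff -> : (fun x => eval (env_sum v (fun i => w (h i) : S (cY (h i)))) (sval (H x))) =
   (fun z => env_sum v w (sval z)) by [].
apply: functional_extensionality_dep => z; exact: (svalP (H z)).
Qed.

Section Types.
Variables (L : language) (S : structure L).

(** A set of elements is made into a tuple indexed by itself, so that types over [A] become sets of
    formulas true of a tuple extended by [elt_env]. *)
Definition elt_ctx (A : set (elt S)) (e : {e | A e}) : sort L := tag (sval e).

Definition elt_env (A : set (elt S)) : env S (@elt_ctx A) :=
  fun e => tagged (sval e).

Definition entries (I : Type) (c : I -> sort L) (g : env S c) : set (elt S) :=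
  [set Tagged S (g i) | i in [set: I]].

(** [realizes] asks for one implication, and for formulas with a finite list of parameters. Negation
    gives the other implication, and a formula in the names of all of [A] uses finitely many of
    them. *)
Lemma realizesP (A : set (elt S)) (X : Type) (ctx : X -> sort L)
    (v w : env S ctx) :
  realizes (tp A v) w <->
  forall phi : formula (sctx ctx (@elt_ctx A)),
    sat (env_sum v (@elt_env A)) phi <-> sat (env_sum w (@elt_env A)) phi.
Proof.
split=> H; last first.
  case=> n ps phi pv [pA] /=; rewrite /psat /= => vphi.
  pose z i : {e | A e} := exist A (Tagged S (pv i)) (pA _ (ex_intro2 _ _ i I erefl)).
  have [psi P] : @fodef L unit (fun=> S) (X + {e | A e}) (sctx ctx (@elt_ctx A))
      (fun _ u => sat (env_sum (fun x => u (inl x)) (fun i => u (inr (z i)))) phi).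
    apply: fodef_sat => -[x|i]; first by exists (Var (sctx ctx (@elt_ctx A)) (inl x)).
    by exists (Var (sctx ctx (@elt_ctx A)) (inr (z i))).
  by move: vphi; rewrite -[X in X -> _](P tt (env_sum v (@elt_env A))) H P.
have {}H (phi : formula (sctx ctx (@elt_ctx A))) :
    sat (env_sum v (@elt_env A)) phi -> sat (env_sum w (@elt_env A)) phi.
  have [n [h [psi P]]] := fm_params_finite phi.
  rewrite !P => vphi.
  apply: (H (@PFormula L S X ctx n (fun i => elt_ctx (h i)) psi
     (fun i => elt_env (h i)))); split=> // _ [i _ <-] /=.
  rewrite /elt_env /elt_ctx /=; case: (h i) => -[s a] Aa //=.
move=> phi; split; first exact: H.
move=> wphi; apply: contrapT => vphi.
exact: (H (Imp phi (Bot _)) vphi wphi).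
Qed.

Lemma saturated_ex (lam I : Type) (c : I -> sort L) (g : env S c) (s : sort L)
    (P : set (formula (oapp c s))) :
  saturated lam S -> small lam (entries g) ->
  (forall n (f : 'I_n -> formula (oapp c s)), (forall k, P (f k)) ->
     exists b, forall k, sat (env_bind g b) (f k)) ->
  exists b, forall phi, P phi -> sat (env_bind g b) phi.
Proof.
move=> Ssat gsm Pfin.
(* All parametrized formulas equivalent to a member of [P], so that no listing of the parameters has
   to be fixed. *)
pose p := [set pf : pformula S (fun _ : unit => s) | params pf `<=` entries g /\
   exists phi, P phi /\ forall b, psat (single b) pf <-> sat (env_bind g b) phi].
have [b bp] : exists b, realizes p b.
  apply: (Ssat (entries g)) => // [pf [] //|q qp /finite_enum[n [h hE]]].
  have /(_ _)/cid H k : exists phi, P phi /\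
       forall b, psat (single b) (h k) <-> sat (env_bind g b) phi.
    have qk : q (h k) by rewrite -hE; exists k.
    by have [_ H] := qp _ qk.
  have [k|b Hb] := Pfin n (fun k => sval (H k)); first by case: (svalP (H k)).
  exists (single b) => pf; rewrite -hE => -[k _ <-].
  case: (svalP (H k)) => _ ->; exact: Hb.
exists (b tt) => phi Pphi.
have [psi Psi] : @fodef L (structure L) id (unit + I) (sctx (fun=> s) c)
   (fun i u => sat (env_bind (fun x => u (inr x)) (u (inl tt))) phi).
  apply: fodef_sat => -[x|]; first by exists (Var (sctx (fun=> s) c) (inr x)).
  by exists (Var (sctx (fun=> s) c) (inl tt)).
have [n [h [chi Chi]]] := fm_params_finite psi.
pose pf := @PFormula L S unit (fun=> s) n (fun i => c (h i)) chi (fun i => g (h i)).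
have pfE b' : psat (single b') pf <-> sat (env_bind g b') phi.
  by rewrite /psat /= -(Chi S (single b') g) Psi.
have b1 : b = single (b tt) by apply: functional_extensionality_dep => -[].
rewrite -pfE -b1; apply: bp; split; first by move=> _ [i _ <-] /=; exists (h i).
by exists phi.
Qed.

End Types.

(** * Cardinality *)

Lemma card_leTP (T U : Type) (A : set T) : inhabited U ->
  A #<= [set: U] <-> exists f : T -> U, forall x y, A x -> A y -> f x = f y -> x = y.
Proof.
move=> [u0]; split=> [/card_leP[f]|[f finj]].
  have finj : injective f by move=> x y; apply: (@inj _ _ _ f); rewrite in_setE.
  exists (fun x => match pselect (A x) with
    | left Ax => set_val (f (SigSub (mem_set Ax) : A)) | right _ => u0 end).
  move=> x y Ax Ay; case: pselect => // Ax'; case: pselect => // Ay' /val_inj/finj.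
  by move=> /(congr1 val).
have [g] : $|{injfun A >-> [set: U]}|.
  apply/injfunPex; exists f => // x y /set_mem Ax /set_mem Ay; exact: finj.
exact: inj_card_le.
Qed.

Lemma infinite_injnat (T : Type) (A : set T) : infinite_set A ->
  exists s : nat -> T, injective s /\ forall n, A (s n).
Proof.
move=> /infiniteP/card_leP[f].
have finj : injective f by move=> x y; apply: (@inj _ _ _ f); rewrite in_setE.
exists (fun n => set_val (f (SigSub (mem_set (I : [set: nat] n))))).
split=> [i k /val_inj/finj/(congr1 val)//|n]; exact: set_valP.
Qed.

(** A maximal family of injective sequences with disjoint ranges misses only finitely many points,
    since an infinite remainder would contain one more sequence. Thus [T] is a disjoint union of
    copies of nat up to a finite set, and each copy absorbs a factor nat. *)
Lemma infinite_mul_nat (T : Type) : infinite_set [set: T] ->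
  exists m : T -> nat -> T, forall x y i k, m x i = m y k -> x = y /\ i = k.
Proof.
move=> Tinf.
pose P := [set F : set (nat -> T) | (forall f, F f -> injective f) /\
  forall f g i k, F f -> F g -> f i = g k -> f = g].
have [|F [[Finj Fdis] Fmax]] := @Zorn_bigcup _ P.
  move=> G GP Gtot; split=> [f [F GF Ff]|f g i k [F GF Ff] [F' GF' F'g] fg].
    exact: ((GP F GF).1 f Ff).
  have [FF'|F'F] := Gtot F F' GF GF'.
    by apply: ((GP F' GF').2 f g i k) => //; exact: FF'.
  by apply: ((GP F GF).2 f g i k) => //; exact: F'F.
pose R := [set t | forall f, F f -> forall n, f n <> t].
have Rfin : finite_set R.
  apply: contrapT => /infinite_injnat[h [hinj hR]].
  apply: (Fmax (F `|` [set h])).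
    split; first exact: subsetUl.
    by move=> /(_ h (or_intror erefl)) Fh; apply: (hR 0 h Fh 0).
  split=> [f [/Finj//|->//]|f g i k [Ff|->] [Fg|->]] //.
  - exact: Fdis.
  - by move=> e; case: (hR k f Ff i).
  - by move=> e; case: (hR i g Fg k).
have [f0 Ff0] : exists f0, F f0.
  apply: contrapT => F0; apply: Tinf; apply: sub_finite_set Rfin => t _ f Ff.
  by case: F0; exists f.
have /card_leTP[|r rinj] : R #<= [set: nat] by exact: finite_set_countable.
  exact: (inhabits 0).
(* A point is addressed by a sequence and a position: even positions for points on a sequence, odd
   positions of [f0] for the finite remainder. *)
have /(_ _)/cid c t : exists p : (nat -> T) * nat, F p.1 /\
    ((exists n, p.2 = n.*2 /\ p.1 n = t) \/ [/\ R t, p.1 = f0 & p.2 = (r t).*2.+1]).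
  have [Rt|] := pselect (R t); first by exists (f0, (r t).*2.+1); split=> //; right.
  move=> /existsNP[f] /not_implyP[Ff /existsNP[n /contrapT fn]].
  by exists (f, n.*2); split=> //=; left; exists n.
exists (fun t k => (sval (c t)).1 (pickle ((sval (c t)).2, k))) => x y i k.
case: (c x) => -[f p] /= [Ff fx]; case: (c y) => -[g q] /= [Fg gy] e.
have fg : f = g by exact: Fdis e.
subst g; move: (Finj f Ff _ _ e) => /(pcan_inj pickleK)[pq ->]; split=> //.
subst q; case: fx gy => [[n [-> <-]]|[Rx _ ->]] [[n' [e' <-]]|[Ry _ e']] //.
- by rewrite (double_inj e').
- by move/(congr1 odd): e'; rewrite /= !odd_double.
- by move/(congr1 odd): e'; rewrite /= !odd_double.
- by apply: rinj => //; apply: double_inj; case: e'.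
Qed.

Section Small.
Variable V : Type.
Hypothesis Vinf : infinite_set [set: V].

Let V0 : inhabited V.
Proof. by have [v _] := infinite_setN0 Vinf; constructor. Qed.

Lemma card_leU (T : Type) (A B : set T) :
  A #<= [set: V] -> B #<= [set: V] -> (A `|` B) #<= [set: V].
Proof.
move=> /(card_leTP _ V0)[f fi] /(card_leTP _ V0)[g gi]; apply/(card_leTP _ V0).
have [m mi] := infinite_mul_nat Vinf.
exists (fun x => if pselect (A x) then m (f x) 0 else m (g x) 1) => x y.
by case: pselect => Ax; case: pselect => Ay ABx ABy /mi[e] //= _;
  [apply: fi|apply: gi => //; [case: ABx|case: ABy]].
Qed.

Lemma card_le_fin (T : Type) (A : set T) : finite_set A -> A #<= [set: V].
Proof.
by move=> /finite_set_countable Ac; apply: card_le_trans Ac _; apply/infiniteP.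
Qed.

(** This bounds the number of coordinates of representatives of a small set of imaginaries: each
    coordinate is found from an imaginary [t] and an index [n]. *)
Lemma card_le_mul_nat (T U : Type) (D : set T) (B : set U)
    (h : T -> nat -> U -> Prop) :
  (forall t n u u', h t n u -> h t n u' -> u = u') ->
  D #<= [set: V] -> (forall u, B u -> exists t n, D t /\ h t n u) ->
  B #<= [set: V].
Proof.
move=> hfun /(card_leTP _ V0)[f fi] Bh.
have [m mi] := infinite_mul_nat Vinf.
have [v0] := V0.
have /(_ _)/cid c u : exists v, B u -> exists t n, [/\ D t, h t n u & v = m (f t) n].
  have [Bu|nBu] := pselect (B u); last by exists v0.
  by have [t [n [Dt hu]]] := Bh u Bu; exists (m (f t) n) => _; exists t, n.
apply/(card_leTP _ V0); exists (fun u => sval (c u)) => x y Bx By.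
have [t [n [Dt hx ->]]] := svalP (c x) Bx.
have [t' [n' [Dt' hy ->]]] := svalP (c y) By.
by move=> /mi[/fi e nn]; apply: hfun hx _; rewrite e // nn.
Qed.

End Small.

(** Infinity becomes one condition for each [k], and for a definable set each of these is
    first-order. *)
Lemma infinite_inj_ord (T : Type) (A : set T) :
  infinite_set A <->
  forall k, exists w : 'I_k -> T, injective w /\ forall i, A (w i).
Proof.
split=> [/infinite_injnat[s [si sA]] k|H /finite_setP[n An]].
  by exists (fun i : 'I_k => s i); split=> // i i' /si/val_inj.
have [w [wi wA]] := H n.+1.
suff : `I_n.+1 #<= `I_n by rewrite card_le_II ltnn.
rewrite -(card_le_eqr An).
have /card_le_eql -> := @card_II n.+1.
have [g] : $|{injfun [set: 'I_n.+1] >-> A}|.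
  by apply/injfunPex; exists w => // x y _ _; exact: wi.
exact: inj_card_le.
Qed.

(** * Elementary correspondences and algebraic closure *)

Lemma dep_choice (X : Type) (T : X -> Type) (P : forall x, T x -> Prop) :
  (forall x, exists t, P x t) -> exists h : forall x, T x, forall x, P x (h x).
Proof.
by move=> /(_ _)/cid H; exists (fun x => sval (H x)) => x; exact: (svalP (H x)).
Qed.

(** Two structures are allowed, so that equality of types and elementary maps between different
    models are one notion. *)
Definition eqv (L : language) (S S' : structure L) (I : Type) (c : I -> sort L)
    (f : env S c) (g : env S' c) : Prop :=
  forall phi : formula c, sat f phi <-> sat g phi.

(** A single formula is the witness, unlike in [acl], so this notion is preserved by [eqv] between
    any two structures. *)
Definition alg_over (L : language) (S : structure L) (I : Type)
    (c : I -> sort L) (g : env S c) (s : sort L) (b : S s) : Prop :=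
  exists phi : formula (oapp c s), sat (env_bind g b) phi /\
    finite_set [set b' | sat (env_bind g b') phi].

(** With variables as terms, this covers every reindexing of tuples below. *)
Lemma eqv_subst (L : language) (S S' : structure L) (X Y : Type)
    (cX : X -> sort L) (cY : Y -> sort L) (f : env S cX) (g : env S' cX)
    (f' : env S cY) (g' : env S' cY) :
  (forall y, exists t : term cX (cY y), eval f t = f' y /\ eval g t = g' y) ->
  eqv f g -> eqv f' g'.
Proof.
move=> /dep_choice[h H] fg phi.
have E : (fun y => eval f (h y) : S (cY y)) = f'.
  by apply: functional_extensionality_dep => y; case: (H y).
have E' : (fun y => eval g (h y) : S' (cY y)) = g'.
  by apply: functional_extensionality_dep => y; case: (H y).
by rewrite -E -E' -!sat_fsubst fg.
Qed.

Lemma alg_over_sub (L : language) (S : structure L) (X Y : Type)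
    (cX : X -> sort L) (cY : Y -> sort L) (g : env S cX) (g' : env S cY)
    (s : sort L) (b : S s) :
  entries g `<=` entries g' -> alg_over g b -> alg_over g' b.
Proof.
move=> gg' [phi [phib phifin]].
have /(_ _)/cid H x : exists t : term cY (cX x), eval g' t = g x.
  have [|y _] := gg' (Tagged S (g x)); first by exists x.
  move: (g x) => a e.
  (* Stated through the tagged pair, so that [e], an equation between elements whose sorts are not
     syntactically equal, can be rewritten. *)
  have : exists t : term cY (tag (Tagged S a)), eval g' t = tagged (Tagged S a).
    by rewrite -e; exists (Var cY y).
  by [].
have E b' : sat (env_bind g' b') (fsubst phi (tlift (fun x => sval (H x)) s)) <->
    sat (env_bind g b') phi.
  rewrite sat_fsubst eval_tlift.
  suff -> : (fun x => eval g' (sval (H x)) : S (cX x)) = g by [].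
  by apply: functional_extensionality_dep => x; case: (H x).
exists (fsubst phi (tlift (fun x => sval (H x)) s)); rewrite E; split=> //.
by apply: sub_finite_set phifin => b' /=; rewrite E.
Qed.

Lemma entries_elt_env (L : language) (S : structure L) (A : set (elt S)) :
  entries (@elt_env L S A) = A.
Proof.
apply/seteqP; split=> [_ [[[s a] Aa] _ <-]//|[s a] Aa].
by exists (exist A (Tagged S a) Aa).
Qed.

Lemma entries_sum (L : language) (S : structure L) (X Y : Type)
    (cX : X -> sort L) (cY : Y -> sort L) (g : env S cX) (g' : env S cY) :
  entries (env_sum g g') = entries g `|` entries g'.
Proof.
apply/seteqP; split=> [_ [[x|y] _ <-]|e [[x _ <-]|[y _ <-]]].
- by left; exists x.
- by right; exists y.
- by exists (inl x).
- by exists (inr y).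
Qed.

Lemma entries_bind (L : language) (S : structure L) (X : Type)
    (cX : X -> sort L) (g : env S cX) (s : sort L) (b : S s) :
  entries (env_bind g b) = entries g `|` [set Tagged S b].
Proof.
apply/seteqP; split=> [_ [[x|] _ <-]|e [[x _ <-]|->]].
- by left; exists x.
- by right.
- by exists (Some x).
- by exists None.
Qed.

Lemma fodef_atleast (L : language) (X : Type) (ctx : X -> sort L) (s : sort L)
    (phi : formula (oapp ctx s)) (k : nat) :
  @fodef L (structure L) id X ctx (fun S v => exists w : env S (fun _ : 'I_k => s),
    injective w /\ forall i, sat (env_bind v (w i)) phi).
Proof.
apply: fodef_exn; apply: fodef_and.
  apply: (@fodef_ext _ _ id _ (sctx ctx (fun _ : 'I_k => s)) (fun S v => forall i i' : 'I_k,
      i <> i' -> v (inr i) <> v (inr i'))).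
    move=> S v; split=> [H i i' + e|H i i' e]; first by case; apply: H.
    by apply: contrapT => /H; apply.
  apply: fodef_alln => i; apply: fodef_alln => i'.
  have [->|/eqP ii'] := eqVneq i i'.
    apply: (@fodef_ext _ _ id _ (sctx ctx (fun _ : 'I_k => s)) (fun _ _ => False -> False)) => //.
    exact: fodef_imp (fodef_false _ _) (fodef_false _ _).
  apply: (@fodef_ext _ _ id _ (sctx ctx (fun _ : 'I_k => s)) (fun S v => v (inr i) <> v (inr i'))).
    by move=> S v; split=> // /(_ ii').
  apply: fodef_not; apply: fodef_eq; first by exists (Var (sctx ctx (fun _ : 'I_k => s)) (inr i)).
  by exists (Var (sctx ctx (fun _ : 'I_k => s)) (inr i')).
apply: fodef_alln => i; apply: fodef_sat => -[x|].
  by exists (Var (sctx ctx (fun _ : 'I_k => s)) (inl x)).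
by exists (Var (sctx ctx (fun _ : 'I_k => s)) (inr i)).
Qed.

Lemma eqv_infinite (L : language) (S S' : structure L) (X : Type)
    (ctx : X -> sort L) (f : env S ctx) (g : env S' ctx) (s : sort L)
    (phi : formula (oapp ctx s)) : eqv f g ->
  infinite_set [set b | sat (env_bind f b) phi] ->
  infinite_set [set b | sat (env_bind g b) phi].
Proof.
move=> fg /infinite_inj_ord H; apply/infinite_inj_ord => k.
have [psi P] := fodef_atleast phi k.
have /(P S f)/fg := H k; exact: (P S' g).1.
Qed.

Lemma eqv_alg_over (L : language) (S S' : structure L) (X : Type)
    (ctx : X -> sort L) (f : env S ctx) (g : env S' ctx) (s : sort L)
    (a : S s) (b : S' s) : eqv (env_bind f a) (env_bind g b) ->
  alg_over f a <-> alg_over g b.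
Proof.
move=> fg; have fg0 : eqv f g.
  by apply: eqv_subst fg => x; exists (Var (oapp ctx s) (Some x)).
split=> -[phi [phia fin]]; exists phi; split.
- by rewrite -fg.
- by apply: contrapT => /(eqv_infinite (g := f)) H; apply: H fin => psi; split=> /fg0.
- by rewrite fg.
- by apply: contrapT => /(eqv_infinite fg0); apply.
Qed.

Lemma eqv_sym (L : language) (S S' : structure L) (X : Type)
    (ctx : X -> sort L) (f : env S ctx) (g : env S' ctx) : eqv f g -> eqv g f.
Proof. by move=> fg phi; rewrite fg. Qed.

(** The witness [chi] asks for some [y] satisfying [psi] such that [th] holds over [y] and has fewer
    than [k] solutions there. Without the last clause a conjugate of [d] could contribute infinitely
    many solutions. *)
Lemma alg_over_bind (L : language) (S : structure L) (X : Type)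
    (ctx : X -> sort L) (g : env S ctx) (s s' : sort L) (d : S s') (b : S s) :
  alg_over (env_bind g d) b -> alg_over g d -> alg_over g b.
Proof.
move=> [th [thb thfin]] [psi [psid psifin]].
have [k kP] : exists k, ~ exists w : 'I_k -> S s,
    injective w /\ forall i, sat (env_bind (env_bind g d) (w i)) th.
  apply: contrapT => H; move: thfin; apply/infinite_inj_ord => k.
  by apply: contrapT => N; apply: H; exists k.
have [th' T] := fodef_atleast th k.
have [chi C] : @fodef L unit (fun=> S) (option X) (oapp ctx s) (fun _ v =>
    exists y, sat (env_bind (fun x => v (Some x)) y) psi /\
      sat (env_bind (env_bind (fun x => v (Some x)) y) (v None)) th /\
      ~ sat (env_bind (fun x => v (Some x)) y) th').
  have d1 : forall o : option X, tmdef (St := fun _ : unit => S) (fun i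
     (v : env S (oapp (oapp ctx s) s')) =>
       env_bind (fun x => v (Some (Some x)) : S (ctx x)) (v None) o).
    case=> [x|]; first by exists (Var (oapp (oapp ctx s) s') (Some (Some x))).
    by exists (Var (oapp (oapp ctx s) s') None).
  apply: fodef_ex; apply: fodef_and; first exact: (fodef_sat (St := fun=> S) psi d1).
  apply: fodef_and; last first.
    by apply: fodef_not; exact: (fodef_sat (St := fun=> S) th' d1).
  apply: fodef_sat => -[[x|]|].
  - by exists (Var (oapp (oapp ctx s) s') (Some (Some x))).
  - by exists (Var (oapp (oapp ctx s) s') None).
  - by exists (Var (oapp (oapp ctx s) s') (Some None)).
exists chi; split.
  by apply/(C tt); exists d; split=> //; split=> //; rewrite T.
have : finite_set (\bigcup_(y in [set y | sat (env_bind g y) psi /\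
    ~ sat (env_bind g y) th']) [set x | sat (env_bind (env_bind g y) x) th]).
  apply: bigcup_finite; first by apply: sub_finite_set psifin => y [].
  move=> y [_ Ny]; apply: contrapT => /infinite_inj_ord/(_ k) H.
  by apply: Ny; rewrite T.
by apply: sub_finite_set => x /= /(C tt) [y [? []]]; exists y.
Qed.

Lemma realizes_eqv (L : language) (S : structure L) (A : set (elt S))
    (X : Type) (ctx : X -> sort L) (v w : env S ctx) :
  realizes (tp A v) w <-> eqv (env_sum v (@elt_env L S A)) (env_sum w (@elt_env L S A)).
Proof. exact: realizesP. Qed.

Lemma realizes_single (L : language) (S : structure L) (A : set (elt S))
    (s : sort L) (b b' : S s) :
  realizes (tp A (single b)) (single b') <->
  eqv (env_bind (@elt_env L S A) b) (env_bind (@elt_env L S A) b').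
Proof.
rewrite realizes_eqv; split; apply: eqv_subst.
  case=> [x|]; first by exists (Var (sctx (fun _ : unit => s) (@elt_ctx L S A)) (inr x)).
  by exists (Var (sctx (fun _ : unit => s) (@elt_ctx L S A)) (inl tt)).
case=> [[]|x]; first by exists (Var (oapp (@elt_ctx L S A) s) None).
by exists (Var (oapp (@elt_ctx L S A) s) (Some x)).
Qed.

Lemma aclE (L : language) (S : structure L) (A : set (elt S)) (s : sort L) (b : S s) :
  acl A (Tagged S b) <-> finite_set [set b' |
     eqv (env_bind (@elt_env L S A) b) (env_bind (@elt_env L S A) b')].
Proof.
rewrite /acl /algebraic /=; split=> fin.
  apply: sub_finite_set (finite_image (fun w : env S (fun _ : unit => s) => w tt) fin).
  by move=> b' /= /realizes_single H; exists (single b').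
apply: sub_finite_set (finite_image (fun b' : S s => single b') fin) => w /= H.
have e : single (w tt) = w by apply: functional_extensionality_dep => -[].
by exists (w tt) => //=; apply/realizes_single; rewrite e.
Qed.

Lemma acl_mono (L : language) (S : structure L) (A B : set (elt S)) :
  A `<=` B -> acl A `<=` acl B.
Proof.
move=> AB [s b]; apply: sub_finite_set => w /= H phi [pA pb].
by apply: H; split=> //; apply: subset_trans AB.
Qed.

Lemma alg_over_acl (L : language) (S : structure L) (X : Type)
    (c : X -> sort L) (g : env S c) (s : sort L) (b : S s) :
  alg_over g b -> acl (entries g) (Tagged S b).
Proof.
rewrite -[entries g]entries_elt_env => H.
have {H}[phi [phib fin]] : alg_over (@elt_env L S (entries g)) b.
  by apply: alg_over_sub H; rewrite entries_elt_env.
rewrite entries_elt_env; apply/aclE; apply: sub_finite_set fin => b' /= H.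
by rewrite -H.
Qed.

Lemma acl_self (L : language) (S : structure L) (A : set (elt S)) : A `<=` acl A.
Proof.
move=> [s b] Ab; apply: (@acl_mono _ _ [set Tagged S b]); first by move=> _ ->.
have -> : [set Tagged S b] = entries (fun _ : unit => b : S ((fun _ : unit => s) tt)).
  by apply/seteqP; split=> [_ ->|_ [_ _ <-]//]; exists tt.
apply: alg_over_acl; exists (Eq (Var (oapp (fun _ : unit => s) s) (Some tt))
  (Var (oapp (fun _ : unit => s) s) None)); split=> //=.
by apply: sub_finite_set (finite_set1 b) => b' /= ->.
Qed.

Lemma eqv_ex_conj (L : language) (S S' : structure L) (X : Type)
    (c : X -> sort L) (f : env S c) (g : env S' c) (s : sort L) (b : S s)
    (n : nat) (F : 'I_n -> formula (oapp c s)) : eqv f g ->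
  (forall k, sat (env_bind f b) (F k)) ->
  exists b', forall k, sat (env_bind g b') (F k).
Proof.
move=> fg Fb.
have [psi P] : @fodef L (structure L) id X c (fun S v => exists b : S s,
    forall k, sat (env_bind v b) (F k)).
  apply: fodef_ex; apply: fodef_alln => k; apply: fodef_sat => -[x|].
    by exists (Var (oapp c s) (Some x)).
  by exists (Var (oapp c s) None).
by apply/(P S' g)/fg/P; exists b.
Qed.

Lemma env_cons (L : language) (S : structure L) n (c : 'I_n.+1 -> sort L)
    (b : S (c ord0)) (w : env S (fun i => c (lift ord0 i))) :
  exists w' : env S c, w' ord0 = b /\ forall i, w' (lift ord0 i) = w i.
Proof.
have @w' : env S c.
  by move=> k; case: (unliftP ord0 k) => [j ->|->]; [exact: w j|exact: b].
exists w'; split=> [|j]; rewrite /w'; case: unliftP => [j' e|e].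
- by case/eqP: (neq_lift ord0 j').
- by rewrite (eq_irrelevance e erefl).
- have ej : j = j' by apply: lift_inj e.
  by subst j'; rewrite (eq_irrelevance e erefl).
- by have /eqP[] := neq_lift ord0 j.
Qed.

(** * Extension of elementary correspondences and algebraic closure in saturated structures *)

Section Saturated.
Variables (lam : Type) (L : language) (S : structure L).
Hypotheses (lam_inf : infinite_set [set: lam]) (S_sat : saturated lam S).

Lemma eqv_ext (S' : structure L) (X : Type) (c : X -> sort L) (f : env S' c)
    (g : env S c) (s : sort L) (b : S' s) :
  small lam (entries g) -> eqv f g ->
  exists b', eqv (env_bind f b) (env_bind g b').
Proof.
move=> gsm fg.
have [n F Fb|b' Hb'] := saturated_ex (P := [set phi | sat (env_bind f b) phi]) S_sat gsm.
  exact: eqv_ex_conj Fb.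
exists b' => phi; split=> [|H]; first exact: Hb'.
by apply: contrapT => N; have := Hb' (Imp phi (Bot _)) N; apply.
Qed.

(** A formula true of the non-algebraic [b] has infinitely many solutions over [f], hence over [g],
    so the type of [b] stays finitely satisfiable after finite sets are removed. The tuple [d] to be
    avoided lives in [S] and has no counterpart beside [f]. *)
Lemma eqv_ext_nonalg (S' : structure L) (X Y : Type) (c : X -> sort L)
    (f : env S' c) (g : env S c) (cD : Y -> sort L) (d : env S cD)
    (s : sort L) (b : S' s) :
  small lam (entries g) -> small lam (entries d) -> eqv f g ->
  ~ alg_over f b ->
  exists b', eqv (env_bind f b) (env_bind g b') /\
    ~ alg_over (env_sum g d) b'.
Proof.
move=> gsm dsm fg nb.
have ssm : small lam (entries (env_sum g d)).
  by rewrite entries_sum; exact: card_leU.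
pose inl' := fun (phi : formula (oapp c s)) (psi : formula (oapp (sctx c cD) s)) =>
  forall b', sat (env_bind (env_sum g d) b') psi <-> sat (env_bind g b') phi.
have inl'P phi : exists psi, inl' phi psi.
  have [psi P] : @fodef L unit (fun=> S) (option (X + Y)) (oapp (sctx c cD) s)
      (fun _ v => sat (env_bind (fun x => v (Some (inl x)) : S (c x)) (v None)) phi).
    apply: fodef_sat => -[x|].
      by exists (Var (oapp (sctx c cD) s) (Some (inl x))).
    by exists (Var (oapp (sctx c cD) s) None).
  by exists psi => b'; rewrite (P tt).
(* The second clause adds every formula over [g] and [d] with finitely many exceptions; an element
   satisfying all of these lies in no finite definable set. *)
pose P := [set psi | (exists phi, sat (env_bind f b) phi /\ inl' phi psi) \/
   finite_set [set b' | ~ sat (env_bind (env_sum g d) b') psi]].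
have [n F FP|b' Hb'] := saturated_ex (P := P) S_sat ssm.
  (* Each condition is reduced to a formula of the type of [b] and a finite set of exceptions; a
     cofinite condition gets a trivially true formula. *)
  have /dep_choice[G GP] k : exists phi, sat (env_bind f b) phi /\
      finite_set [set b' | sat (env_bind g b') phi /\
        ~ sat (env_bind (env_sum g d) b') (F k)].
    have [[phi [phib H]]|fin] := FP k.
      exists phi; split=> //; apply: sub_finite_set (finite_set0 (S s)) => b' /=.
      by case=> ?; apply; rewrite H.
    exists (Imp (Bot _) (Bot _)); split=> //.
    by apply: sub_finite_set fin => b' /= [].
  have [chi C] : @fodef L (structure L) id (option X) (oapp c s) (fun S v =>
      forall k, sat v (G k)).
    by apply: fodef_alln => k; exists (G k).
  have chi_inf : infinite_set [set b' | sat (env_bind g b') chi].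
    apply: (eqv_infinite fg) => fin; apply: nb; exists chi; split=> //.
    by rewrite C => k; case: (GP k).
  have bad_fin : finite_set (\bigcup_(k in [set: 'I_n]) [set b' |
      sat (env_bind g b') (G k) /\ ~ sat (env_bind (env_sum g d) b') (F k)]).
    by apply: bigcup_finite => [|k _]; [exact: finite_finset|case: (GP k)].
  apply: contrapT => N; apply: chi_inf; apply: sub_finite_set bad_fin => b' /=.
  move=> /C H; apply: contrapT => N'; apply: N; exists b' => k.
  by apply: contrapT => N; apply: N'; exists k.
have H phi : sat (env_bind f b) phi -> sat (env_bind g b') phi.
  move=> phib; have [psi Psi] := inl'P phi.
  by rewrite -Psi; apply: Hb'; left; exists phi.
exists b'; split=> [phi|[psi [psib' fin]]].
  split=> [|phib']; first exact: H.
  by apply: contrapT => N; have := H (Imp phi (Bot _)) N; apply.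
suff : sat (env_bind (env_sum g d) b') (Imp psi (Bot _)) by apply.
by apply: Hb'; right; apply: sub_finite_set fin => b1 /= /contrapT.
Qed.

(** If no formula witnesses algebraicity, then [eqv_ext_nonalg], with [d] a list of all realizations
    of the type, produces a realization that is not on the list. *)
Lemma acl_alg_over (X : Type) (c : X -> sort L) (g : env S c) (s : sort L)
    (b : S s) : small lam (entries g) ->
  acl (entries g) (Tagged S b) <-> alg_over g b.
Proof.
move=> gsm; split; last exact: alg_over_acl.
rewrite -{1}[entries g]entries_elt_env => H.
suff : alg_over (@elt_env L S (entries g)) b.
  by apply: alg_over_sub; rewrite entries_elt_env.
apply: contrapT => N; move: H; rewrite entries_elt_env => /aclE/finite_enum[n [r rE]].
have [||||b' [bb' N']] := @eqv_ext_nonalg S _ _ _ (@elt_env L S (entries g))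
  (@elt_env L S (entries g)) (fun _ : 'I_n => s) r s b.
- by rewrite entries_elt_env.
- by apply: card_le_fin => //; apply: finite_image; exact: finite_finset.
- by move=> psi.
- by [].
have : range r b' by rewrite rE.
move=> [k _ rk]; apply: N'.
exists (Eq (Var (oapp (sctx (@elt_ctx L S (entries g)) (fun _ : 'I_n => s)) s) (Some (inr k)))
           (Var (oapp (sctx (@elt_ctx L S (entries g)) (fun _ : 'I_n => s)) s) None)).
split=> //=; rewrite rk; apply: sub_finite_set (finite_set1 b') => b1 /= ->.
by [].
Qed.

Lemma acl_finite_character (B : set (elt S)) (e : elt S) :
  small lam B -> acl B e ->
  exists B0, [/\ finite_set B0, B0 `<=` B & acl B0 e].
Proof.
case: e => s b Bsm; rewrite -{1}[B]entries_elt_env.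
rewrite acl_alg_over ?entries_elt_env // => -[phi [phib fin]].
have [psi P] : @fodef L (structure L) id (unit + {e | B e}) (sctx (fun=> s) (@elt_ctx L S B))
   (fun _ u => sat (env_bind (fun x => u (inr x)) (u (inl tt))) phi).
  apply: fodef_sat => -[x|].
    by exists (Var (sctx (fun=> s) (@elt_ctx L S B)) (inr x)).
  by exists (Var (sctx (fun=> s) (@elt_ctx L S B)) (inl tt)).
have [n [h [chi C]]] := fm_params_finite psi.
pose g : env S (fun i => elt_ctx (h i)) := fun i => elt_env (h i).
have [th T] : @fodef L (structure L) id (option 'I_n) (oapp (fun i => elt_ctx (h i)) s)
   (fun _ u => sat (env_sum (single (u None)) (fun i => u (Some i))) chi).
  apply: fodef_sat => -[x|i].
    by exists (Var (oapp (fun i => elt_ctx (h i)) s) None).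
  by exists (Var (oapp (fun i => elt_ctx (h i)) s) (Some i)).
have thE b' : sat (env_bind g b') th <-> sat (env_bind (@elt_env L S B) b') phi.
  by rewrite T -(C S (single b') (@elt_env L S B)) P.
exists (entries g); split.
- by apply: finite_image; exact: finite_finset.
- move=> _ [i _ <-]; rewrite /g /elt_env /elt_ctx; case: (h i) => -[s' a] Ba.
  exact: Ba.
apply: alg_over_acl; exists th; rewrite thE; split=> //.
by apply: sub_finite_set fin => b' /=; rewrite thE.
Qed.

Lemma acl_trans1 (A : set (elt S)) (d e : elt S) : small lam A ->
  acl (A `|` [set d]) e -> acl A d -> acl A e.
Proof.
case: d e => sd d [s b] Asm.
rewrite -[A]entries_elt_env -entries_bind.
rewrite !acl_alg_over ?entries_bind ?entries_elt_env //; first exact: alg_over_bind.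
by apply: card_leU => //; apply: card_le_fin => //; exact: finite_set1.
Qed.

Lemma acl_trans (A B : set (elt S)) (e : elt S) : small lam A -> small lam B ->
  B `<=` acl A -> acl B e -> acl A e.
Proof.
move=> Asm Bsm BA /(acl_finite_character Bsm)[_ [/finite_enum[n [h <-]] hB he]].
have {BA hB}hA i : acl A (h i) by apply: BA; apply: hB; exists i.
have {he} : acl (A `|` range h) e by apply: acl_mono he; exact: subsetUr.
elim: n h hA => [|n IH] h hA.
  by apply: acl_mono => x [//|[[]]].
move=> H; apply: (IH (fun i => h (lift ord0 i))) => //.
apply: (acl_trans1 (d := h ord0)); last by apply: acl_mono (hA ord0); exact: subsetUl.
  apply: card_leU => //; apply: card_le_fin => //; apply: finite_image.
  exact: finite_finset.
apply: acl_mono H => x [Ax|[k _ <-]]; first by left; left.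
by case: (unliftP ord0 k) => [j|] ->; [left; right; exists j|right].
Qed.

Lemma small_entries_ord n (c : 'I_n -> sort L) (g : env S c) :
  small lam (entries g).
Proof. by apply: card_le_fin => //; apply: finite_image; exact: finite_finset. Qed.

(** Entries are copied from the last to the first, the order of the freeness condition in weak
    saturation. An entry not algebraic over [f] and the later entries is copied away from [D] by
    [eqv_ext_nonalg], any other entry by [eqv_ext]. *)
Lemma eqv_ext_tuple (S' : structure L) n : forall (cv : 'I_n -> sort L)
    (v : env S' cv) (X : Type) (c : X -> sort L) (f : env S' c) (g : env S c)
    (D : set (elt S)),
  small lam (entries g) -> small lam D -> eqv f g ->
  exists w : env S cv, eqv (env_sum f v) (env_sum g w) /\
    forall i : 'I_n, ~ alg_over (env_sum f (fun k : {k : 'I_n | i < k} =>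
                                       v (sval k) : S' (cv (sval k)))) (v i) ->
      ~ acl (entries g `|` D `|` [set Tagged S (w k) | k in [set k : 'I_n | i < k]])
          (Tagged S (w i)).
Proof.
elim: n => [|n IH] cv v X c f g D gsm Dsm fg.
  have @w : env S cv by case.
  exists w; split; last by case.
  by apply: eqv_subst fg => -[x|[]//]; exists (Var c x).
pose v' : env S' (fun i => cv (lift ord0 i)) := fun i => v (lift ord0 i).
have [w' [fgw wD]] := IH _ v' _ c f g D gsm Dsm fg.
pose F := env_sum f v'; pose G := env_sum g w'.
have Gsm : small lam (entries G).
  by rewrite entries_sum; apply: card_leU => //; exact: small_entries_ord.
have [b' [FGb bD]] : exists b', eqv (env_bind F (v ord0)) (env_bind G b') /\
    (~ alg_over F (v ord0) -> ~ acl (entries G `|` D) (Tagged S b')).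
  have [Fv|Fv] := pselect (alg_over F (v ord0)).
    by have [b' Hb'] := eqv_ext (v ord0) Gsm fgw; exists b'.
  have [|b' [Hb' Nb']] := eqv_ext_nonalg (d := @elt_env L S D) Gsm _ fgw Fv.
    by rewrite entries_elt_env.
  exists b'; split=> // _; rewrite -[D]entries_elt_env -entries_sum.
  rewrite acl_alg_over // entries_sum entries_elt_env; exact: card_leU.
have [w [w0 wS]] := env_cons b' w'.
exists w; split.
  pose cF : option (X + 'I_n) -> sort L :=
    oapp (sctx c (fun i => cv (lift ord0 i))) (cv ord0).
  apply: (eqv_subst (cX := cF)) FGb => -[x|k]; first by exists (Var cF (Some (inl x))).
  case: (unliftP ord0 k) => [j|] ->.
    by exists (Var cF (Some (inr j))); rewrite /= wS.
  by exists (Var cF None); rewrite /= w0.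
move=> i; case: (unliftP ord0 i) => [j|] -> {i} Nv.
  rewrite wS => H; apply: (wD j) => [A|].
    apply: Nv; apply: alg_over_sub A; rewrite !entries_sum => e [|[[k jk] _ <-]].
      by left.
    right; have jk' : lift ord0 j < lift ord0 k by rewrite /= !/bump !leq0n !add1n ltnS.
    by exists (exist (fun k : 'I_n.+1 => lift ord0 j < k) (lift ord0 k) jk').
  apply: acl_mono H => e [|[k /= jk <-]]; first by left.
  right; move: jk; case: (unliftP ord0 k) => [k'|] -> //.
  by rewrite wS /bump !leq0n !add1n ltnS; exists k'.
rewrite w0 => H; apply: bD => [A|].
  apply: Nv; apply: alg_over_sub A; rewrite !entries_sum => e [|[k _ <-]].
    by left.
  right; have k0 : (ord0 : 'I_n.+1) < lift ord0 k by [].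
  by exists (exist (fun k : 'I_n.+1 => ord0 < k) (lift ord0 k) k0).
apply: acl_mono H => e [[ge|De]|[k /= k0 <-]].
- by left; rewrite entries_sum; left.
- by right.
- left; rewrite entries_sum; right; move: k0.
  by case: (unliftP ord0 k) => [k'|] -> //; rewrite wS; exists k'.
Qed.

(** Every conjugate of an entry extends to a conjugate of the whole tuple, so there are no more of
    the former than of the latter. *)
Lemma algebraic_tuple_entry (A : set (elt S)) n (c : 'I_n -> sort L)
    (v : env S c) (j : 'I_n) : small lam A ->
  algebraic A v -> acl A (Tagged S (v j)).
Proof.
move=> Asm fin; apply/aclE.
apply: sub_finite_set (finite_image (fun w : env S c => w j) fin) => b' /= H.
have [||w [fw _]] := eqv_ext_tuple v (D := set0) _ _ H.
- rewrite entries_bind entries_elt_env; apply: card_leU => //.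
  by apply: card_le_fin => //; exact: finite_set1.
- by apply: card_le_fin => //; exact: finite_set0.
exists w.
  apply/realizes_eqv; apply: eqv_subst fw => -[k|e].
    by exists (Var (sctx (oapp (@elt_ctx L S A) (c j)) c) (inr k)).
  by exists (Var (sctx (oapp (@elt_ctx L S A) (c j)) c) (inl (Some e))).
have := fw (Eq (Var (sctx (oapp (@elt_ctx L S A) (c j)) c) (inr j))
  (Var (sctx (oapp (@elt_ctx L S A) (c j)) c) (inl None))).
by move=> /= [-> //].
Qed.

Lemma finite_dep_prod n (T : 'I_n -> Type) (F : forall i, set (T i)) :
  (forall i, finite_set (F i)) ->
  finite_set [set w : forall i, T i | forall i, F i (w i)].
Proof.
move=> Ffin.
have /dep_choice[f fP] i : exists f : T i -> nat,
    forall x y, F i x -> F i y -> f x = f y -> x = y.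
  apply/(card_leTP _ (inhabits 0)); exact: finite_set_countable.
pose U i := f i @` F i.
have [m Um] : exists m, forall i k, U i k -> k < m.
  have Ufin : finite_set (\bigcup_(i in [set: 'I_n]) U i).
    apply: bigcup_finite => [|i _]; first exact: finite_finset.
    exact: finite_image.
  have /finite_seqP[s sE] := Ufin.
  exists (\max_(k <- s) k).+1 => i k Uk; rewrite ltnS.
  have ks : k \in s by have : (\bigcup_(i in [set: 'I_n]) U i) k by [exists i]; rewrite sE.
  exact: (@leq_bigmax_seq _ s xpredT id).
pose code (w : forall i, T i) : {ffun 'I_n -> 'I_m.+1} := [ffun i => inord (f i (w i))].
apply: contrapT => /infinite_inj_ord/(_ #|{ffun 'I_n -> 'I_m.+1}|.+1)[w [winj wF]].
have : injective (fun k => code (w k)).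
  move=> k k' e; apply: winj; apply: functional_extensionality_dep => i.
  apply: (fP i); [exact: wF|exact: wF|].
  have := congr1 (fun g : {ffun 'I_n -> 'I_m.+1} => val (g i)) e; rewrite /code !ffunE.
  by rewrite /= !inordK // ltnS ltnW //; apply: (Um i); apply: imageP; exact: wF.
by move=> /leq_card; rewrite card_ord ltnn.
Qed.

Lemma algebraic_tuple (A : set (elt S)) n (c : 'I_n -> sort L)
    (v : env S c) : (forall j, acl A (Tagged S (v j))) -> algebraic A v.
Proof.
move=> H; have /finite_dep_prod : forall i, finite_set [set b' |
     eqv (env_bind (@elt_env L S A) (v i)) (env_bind (@elt_env L S A) b')].
  by move=> i; apply/aclE; exact: H.
apply: sub_finite_set => w /= /realizes_eqv H' i; apply: eqv_subst H' => -[x|].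
  by exists (Var (sctx c (@elt_ctx L S A)) (inr x)).
by exists (Var (sctx c (@elt_ctx L S A)) (inl i)).
Qed.

End Saturated.

(** Saturation concerns single elements, while an imaginary is represented by a tuple. Coordinate 0
    is realized alone, and the others over it by induction. *)
Lemma saturated_tuple (lam : Type) (L : language) (S : structure L) :
  infinite_set [set: lam] -> saturated lam S ->
  forall n (cv : 'I_n -> sort L) (I : Type) (c : I -> sort L) (g : env S c)
    (P : set (formula (sctx c cv))),
  small lam (entries g) ->
  (forall k (f : 'I_k -> formula (sctx c cv)), (forall i, P (f i)) ->
     exists w : env S cv, forall i, sat (env_sum g w) (f i)) ->
  exists w : env S cv, forall phi, P phi -> sat (env_sum g w) phi.
Proof.
move=> lam_inf S_sat; elim=> [|n IH] cv I c g P gsm Pfin.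
  have @w : env S cv by case.
  exists w => phi Pphi; have [//|w' /(_ (ord0 : 'I_1))] := Pfin 1 (fun=> phi).
  suff -> : w' = w by [].
  by apply: functional_extensionality_dep => -[].
(* Projections of finite conjunctions, not of single formulas: every finite part of [P] then stays
   satisfiable once coordinate 0 is fixed. *)
pose P1 := [set chi : formula (oapp c (cv ord0)) |
  exists k (f : 'I_k -> formula (sctx c cv)), (forall i, P (f i)) /\
  forall b, sat (env_bind g b) chi <-> exists w : env S cv, w ord0 = b /\
    forall i, sat (env_sum g w) (f i)].
have P1P k (f : 'I_k -> formula (sctx c cv)) : (forall i, P (f i)) ->
    exists chi, P1 chi /\ forall b, sat (env_bind g b) chi ->
      exists w : env S cv, w ord0 = b /\ forall i, sat (env_sum g w) (f i).
  move=> Pf.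
  have [chi C] : @fodef L unit (fun=> S) (option I) (oapp c (cv ord0)) (fun _ v =>
      exists w : env S cv, w ord0 = v None /\
        forall i, sat (env_sum (fun x => v (Some x) : S (c x)) w) (f i)).
    apply: fodef_exn; apply: fodef_and.
      apply: fodef_eq; first by exists (Var (sctx (oapp c (cv ord0)) cv) (inr ord0)).
      by exists (Var (sctx (oapp c (cv ord0)) cv) (inl None)).
    apply: fodef_alln => i; apply: fodef_sat => -[x|j].
      by exists (Var (sctx (oapp c (cv ord0)) cv) (inl (Some x))).
    by exists (Var (sctx (oapp c (cv ord0)) cv) (inr j)).
  exists chi; split; last by move=> b /(C tt).
  by exists k, f; split=> // b; rewrite (C tt).
have [k F FP|b Hb] := saturated_ex (P := P1) S_sat gsm.
  have /dep_choice[m Hm] := FP.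
  have /dep_choice[f Hf] := Hm.
  have [|w Hw] := Pfin #|{: {i : 'I_k & 'I_(m i)}}| (fun j =>
     f (tag (enum_val j)) (tagged (enum_val j))).
    by move=> j; case: (Hf (tag (enum_val j))).
  exists (w ord0) => i; case: (Hf i) => _ ->; exists w; split=> // j.
  by have := Hw (enum_rank (Tagged (fun i => 'I_(m i)) j)); rewrite enum_rankK.
have /dep_choice[tm tmE] (j : 'I_n.+1) : exists t : term (sctx (oapp c (cv ord0))
    (fun j => cv (lift ord0 j))) (cv j), forall w : env S cv,
    eval (env_sum (env_bind g (w ord0)) (fun j => w (lift ord0 j))) t = w j.
  case: (unliftP ord0 j) => [i|] ->.
    by exists (Var (sctx (oapp c (cv ord0)) (fun j => cv (lift ord0 j))) (inr i)).
  by exists (Var (sctx (oapp c (cv ord0)) (fun j => cv (lift ord0 j))) (inl None)).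
pose P2 := [set psi : formula (sctx (oapp c (cv ord0)) (fun j => cv (lift ord0 j))) |
  exists phi, P phi /\ forall w : env S cv, w ord0 = b ->
   (sat (env_sum (env_bind g b) (fun j => w (lift ord0 j) : S (cv (lift ord0 j)))) psi <->
    sat (env_sum g w) phi)].
have [||w' Hw'] := IH _ _ _ (env_bind g b) P2.
- by rewrite entries_bind; apply: card_leU => //; apply: card_le_fin => //; exact: finite_set1.
- move=> k psi Psi; have /dep_choice[f Hf] := Psi.
  have [|chi [P1chi /(_ b (Hb _ P1chi))[w [wb Hw]]]] := P1P _ f.
    by move=> i; case: (Hf i).
  exists (fun j => w (lift ord0 j)) => i; case: (Hf i) => _ H; exact/H.
have [w [w0 wS]] := env_cons b w'.
exists w => phi Pphi.
pose tm' (z : I + 'I_n.+1) : term (sctx (oapp c (cv ord0))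
    (fun j => cv (lift ord0 j))) (sctx c cv z) := match z with
   | inl x => Var (sctx (oapp c (cv ord0)) (fun j => cv (lift ord0 j))) (inl (Some x))
   | inr j => tm j end.
have E (u : env S cv) : u ord0 = b ->
   (sat (env_sum (env_bind g b) (fun j => u (lift ord0 j) : S (cv (lift ord0 j))))
      (fsubst phi tm') <-> sat (env_sum g u) phi).
  move=> ub; rewrite sat_fsubst.
  suff -> : (fun x => eval (env_sum (env_bind g b)
      (fun j => u (lift ord0 j) : S (cv (lift ord0 j)))) (tm' x)) = env_sum g u by [].
  by apply: functional_extensionality_dep => -[x|j] //=; rewrite -ub tmE.
rewrite -E //.
have -> : (fun j => w (lift ord0 j) : S (cv (lift ord0 j))) = w'.
  by apply: functional_extensionality_dep => j; rewrite wS.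
by apply: Hw'; exists phi.
Qed.

(** * Imaginaries *)

Section Imaginaries.
Variables (Sg : signature) (C : hstruct Sg).

Local Notation EL := (eq_lang C).
Local Notation HL := (home_lang Sg).

Definition home_def (X : Type) (R : (X -> home C) -> Prop) : Prop :=
  exists phi : formula (@hctx Sg X), forall v, @sat HL C X (@hctx Sg X) v phi <-> R v.

Lemma home_defE (X : Type) (R : (X -> home C) -> Prop) :
  home_def R <-> @fodef HL unit (fun=> C) X (@hctx Sg X) (fun _ v => R v).
Proof.
by split=> -[p P]; exists p; [move=> [] v; exact: P|move=> v; exact: (P tt)].
Qed.

Lemma home_def_ext (X : Type) (R Q : (X -> home C) -> Prop) :
  (forall v, Q v <-> R v) -> home_def R -> home_def Q.
Proof. by move=> RQ [p P]; exists p => v; rewrite RQ. Qed.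

Lemma home_def_imp (X : Type) (R Q : (X -> home C) -> Prop) :
  home_def R -> home_def Q -> home_def (fun v => R v -> Q v).
Proof. by rewrite !home_defE; exact: fodef_imp. Qed.

Lemma home_def_not (X : Type) (R : (X -> home C) -> Prop) :
  home_def R -> home_def (fun v => ~ R v).
Proof. by rewrite !home_defE; exact: fodef_not. Qed.

Lemma home_def_and (X : Type) (R Q : (X -> home C) -> Prop) :
  home_def R -> home_def Q -> home_def (fun v => R v /\ Q v).
Proof. by rewrite !home_defE; exact: fodef_and. Qed.

Lemma home_def_alln (X : Type) n (R : 'I_n -> (X -> home C) -> Prop) :
  (forall k, home_def (R k)) -> home_def (fun v => forall k, R k v).
Proof.
move=> H; rewrite home_defE; apply: (fodef_alln (R := fun k (_ : unit) v => R k v)) => k.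
by have := H k; rewrite home_defE.
Qed.

Lemma home_def_subst (X Y : Type) (R : (X -> home C) -> Prop) (h : X -> Y) :
  home_def R -> home_def (fun v : Y -> home C => R (fun x => v (h x))).
Proof.
rewrite !home_defE => H.
apply: (fodef_subst (R := fun (_ : unit) v => R v)
  (E := fun (_ : unit) v => (fun x => v (h x))) H) => x.
by exists (Var (@hctx Sg Y) (h x)).
Qed.

Lemma home_def_exn (X : Type) n (R : (X -> home C) -> ('I_n -> home C) -> Prop) :
  home_def (fun v : X + 'I_n -> home C => R (fun x => v (inl x)) (fun i => v (inr i))) ->
  home_def (fun v => exists w, R v w).
Proof.
rewrite !home_defE => H.
apply: (@fodef_exn HL unit (fun=> C) n (fun=> tt) X (@hctx Sg X) (fun _ v w => R v w)).
apply: (fodef_subst (R := fun (_ : unit) (v : X + 'I_n -> home C) =>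
   R (fun x => v (inl x)) (fun i => v (inr i)))
  (E := fun (_ : unit) v z => match z with inl x => v (inl x) | inr i => v (inr i) end) H).
case=> [x|i].
  by exists (Var (sctx (@hctx Sg X) (fun=> tt)) (inl x)).
by exists (Var (sctx (@hctx Sg X) (fun=> tt)) (inr i)).
Qed.

Lemma home_def_eq (X : Type) (x y : X) : home_def (fun v => v x = v y).
Proof. by exists (Eq (Var (@hctx Sg X) x) (Var (@hctx Sg X) y)). Qed.

Lemma home_def_graph (X : Type) (f : sg_fun Sg) (h : 'I_(sg_far f) -> X) (y : X) :
  home_def (fun v => v y = @fint HL C f (fun i => v (h i))).
Proof.
by exists (@Eq HL X (@hctx Sg X) tt (Var (@hctx Sg X) y)
  (@App HL X (@hctx Sg X) f (fun i => Var (@hctx Sg X) (h i)))).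
Qed.

Lemma home_def_rel (X : Type) (r : sg_rel Sg) (h : 'I_(sg_rar r) -> X) :
  home_def (fun v => @rint HL C r (fun i => v (h i))).
Proof. by exists (@Rel HL X (@hctx Sg X) r (fun i => Var (@hctx Sg X) (h i))). Qed.

(* An element of sort [s] of [C^eq] is represented by a home tuple of length
   [rep_ar s]; [rep_val] maps a tuple to the element it represents. *)
Definition rep_ar (s : option (eqrel C)) : nat :=
  if s is Some E then eq_ar E else 1.

Definition rep_val (s : option (eqrel C)) : ('I_(rep_ar s) -> home C) -> Ceq C s :=
  match s return ('I_(rep_ar s) -> home C) -> Ceq C s with
  | None => fun y => y ord0
  | Some E => fun y => @eq_proj Sg C E y
  end.

Lemma rep_val_surj (s : option (eqrel C)) (e : Ceq C s) : exists y, rep_val y = e.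
Proof.
case: s e => [E|] e; last by exists (fun=> e).
case: e => K [a aK]; exists a; rewrite /= /eq_proj; subst K.
by congr exist; exact: Prop_irrelevance.
Qed.

Lemma eq_proj_eq (E : eqrel C) (a b : 'I_(eq_ar E) -> home C) :
  eq_proj a = eq_proj b :> eq_class E <-> defrel (eq_form E) a b.
Proof.
split=> [/(congr1 sval) /= H|ab].
  have : [set b' | defrel (eq_form E) b b'] b by exact: eq_form_refl.
  by rewrite -H.
apply: eq_exist => /=; apply/seteqP; split=> c /=.
  by apply: eq_form_trans; exact: eq_form_sym.
exact: eq_form_trans.
Qed.

Lemma home_def_rep_eq (X : Type) (s : option (eqrel C)) (h h' : 'I_(rep_ar s) -> X) :
  home_def (fun v => rep_val (fun i => v (h i)) = rep_val (fun i => v (h' i))).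
Proof.
case: s h h' => [E|] h h'; last exact: home_def_eq.
apply: (@home_def_ext _ (fun v => defrel (eq_form E) (fun i => v (h i)) (fun i => v (h' i)))).
  by move=> v; exact: eq_proj_eq.
have [p P] := @home_def_subst ('I_(eq_ar E) + 'I_(eq_ar E)) X
  (fun v => @sat HL C _ (@hctx Sg _) v (eq_form E))
  (fun z => match z with inl i => h i | inr i => h' i end)
  (ex_intro _ (eq_form E) (fun v => iff_refl _)).
exists p => v; rewrite P /defrel.
suff -> : (fun x : 'I_(eq_ar E) + 'I_(eq_ar E) => v match x with
                | inl i => h i | inr i => h' i end) =
  (fun z => match z with inl i => v (h i) | inr i => v (h' i) end) by [].
by apply: functional_extensionality_dep => -[].
Qed.

Definition rep_var (X : Type) (ctx : X -> sort EL) : Type :=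
  {x : X & 'I_(rep_ar (ctx x))}.

Definition rep_env (X : Type) (ctx : X -> sort EL) (w : rep_var ctx -> home C) :
    env (Ceq C) ctx :=
  fun x => rep_val (fun i => w (existT _ x i)).

Lemma home_def_term (X : Type) (ctx : X -> sort EL) (s : sort EL) (t : term ctx s) :
  home_def (fun v : rep_var ctx + 'I_(rep_ar s) -> home C =>
    rep_val (fun i => v (inr i)) = eval (rep_env (fun p => v (inl p))) t).
Proof.
elim: t => {s} [x|f args IH].
  exact: (home_def_rep_eq inr (fun i => inl (existT _ x i))).
(* Every function symbol of [eq_lang] takes arguments of the home sort, so one element represents
   each argument. *)
have IH' i : home_def (fun v : rep_var ctx + 'I_1 -> home C =>
    v (inr ord0) = eval (rep_env (fun p => v (inl p))) (args i)) by exact: IH.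
apply: (@home_def_ext _ (fun v => exists z : 'I_(far f) -> home C,
   (forall i, z i = eval (rep_env (fun p => v (inl p))) (args i)) /\
   rep_val (fun i => v (inr i)) = @fint EL (Ceq C) f z)).
  move=> v; split=> [H|[z [Hz ->]]].
    by exists (fun i => eval (rep_env (fun p => v (inl p))) (args i)).
  have -> // : z = (fun i => eval (rep_env (fun p => v (inl p))) (args i)).
  by apply: functional_extensionality_dep => i; exact: Hz.
apply: home_def_exn; apply: home_def_and.
  apply: home_def_alln => i.
  exact: (home_def_subst (fun z : rep_var ctx + 'I_1 => match z with
    | inl p => inl (inl p) | inr _ => inr i end) (IH' i)).
case: f args {IH IH'} => [f|E] args.
  exact: (home_def_graph (fun i => inr i) (inl (inr ord0))).
exact: (@home_def_rep_eq _ (Some E) (fun i => inl (inr i)) (fun i => inr i)).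
Qed.

(** Quantifying over classes amounts to quantifying over representatives, as [rep_val] is
    surjective; an atomic formula passes through representatives of the values of its terms. *)
Lemma home_def_formula (X : Type) (ctx : X -> sort EL) (phi : formula ctx) :
  home_def (fun v : rep_var ctx -> home C => sat (rep_env v) phi).
Proof.
elim: phi => {X ctx} [X ctx|X ctx s t u|X ctx r args|X ctx p P q Q|X ctx s p IH].
- by exists (Bot _).
- apply: (@home_def_ext _ (fun v => exists z : 'I_(rep_ar s) -> home C,
     rep_val z = eval (rep_env v) t /\ rep_val z = eval (rep_env v) u)).
    move=> v /=; split=> [H|[z [<- <-]]//].
    by have [z Hz] := rep_val_surj (eval (rep_env v) t); exists z; rewrite -H.
  by apply: home_def_exn; apply: home_def_and; exact: home_def_term.
- apply: (@home_def_ext _ (fun v => exists z : 'I_(rar r) -> home C,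
     (forall i, z i = eval (rep_env v) (args i)) /\ @rint EL (Ceq C) r z)).
    move=> v; split=> [H|[z [Hz Hr]]].
      by exists (fun i => eval (rep_env v) (args i)).
    rewrite /= (_ : (fun i => _) = z) //.
    by apply: functional_extensionality_dep => i; rewrite Hz.
  apply: home_def_exn; apply: home_def_and.
    apply: home_def_alln => i.
    exact: (home_def_subst (fun z : rep_var ctx + 'I_1 => match z with
      | inl p => inl p | inr _ => inr i end) (home_def_term (args i))).
  exact: (home_def_rel (fun i => inr i)).
- exact: home_def_imp.
- pose h (z : rep_var (oapp ctx s)) : rep_var ctx + 'I_(rep_ar s) :=
    let: existT o i := z in
    match o return 'I_(rep_ar (oapp ctx s o)) -> rep_var ctx + 'I_(rep_ar s) with
    | Some x => fun i => inl (existT _ x i) | None => fun i => inr i end i.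
  apply: (@home_def_ext _ (fun v => ~ exists z : 'I_(rep_ar s) -> home C,
     ~ sat (env_bind (rep_env v) (rep_val z : Ceq C s)) p)).
    move=> v; split=> /= [H [z]|H b]; first by apply; exact: H.
    have [z <-] := rep_val_surj b; apply: contrapT => N; apply: H.
    by exists z.
  apply: home_def_not; apply: home_def_exn; apply: home_def_not.
  apply: home_def_ext (home_def_subst h IH) => v.
  suff -> : env_bind (rep_env (fun p => v (inl p)))
     (rep_val (fun i => v (inr i)) : Ceq C s) = rep_env (fun z => v (h z)) by [].
  by apply: functional_extensionality_dep => -[x|].
Qed.

(** Choosing representatives turns a type of an imaginary over [A] into a type of a tuple over [g],
    the coordinates of the representatives of [A]. These remain few, each element of [A] having
    finitely many. *)
Lemma Ceq_saturated (lam : Type) : infinite_set [set: lam] ->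
  saturated lam C -> saturated lam (Ceq C).
Proof.
move=> lam_inf C_sat A s p Asm pA pfin.
have /dep_choice[rep repE] := fun e : elt (Ceq C) => rep_val_surj (tagged e).
pose J := {z : {e | A e} & 'I_(rep_ar (tag (sval z)))}.
pose g : env C (fun _ : J => tt) := fun z => rep (sval (tag z)) (tagged z).
have gsm : small lam (entries g).
  apply: (@card_le_mul_nat _ lam_inf _ _ A _ (fun e n u =>
    exists i : 'I_(rep_ar (tag e)), i = n :> nat /\ u = @Tagged unit tt C (rep e i))) => //.
    by move=> e n u u' [i [<- ->]] [i' [/val_inj -> ->]].
  by move=> _ [[[e Ae] i] _ <-]; exists e, i; split=> //; exists i.
pose n := rep_ar s.
pose cj : J -> sort HL := fun=> tt; pose cn : 'I_n -> sort HL := fun=> tt.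
pose P := [set psi : formula (sctx cj cn) |
  exists pf, p pf /\ forall y : 'I_n -> home C,
    @sat HL C _ (sctx cj cn) (@env_sum HL C _ _ cj cn g y) psi <-> psat (single (rep_val y)) pf].
have [k F FP|y Hy] := @saturated_tuple lam HL C lam_inf C_sat n cn J cj g P gsm.
  have /dep_choice[G GP] := FP.
  have [||b Hb] := pfin (range G).
  - by move=> _ [i _ <-]; case: (GP i).
  - by apply: finite_image; exact: finite_finset.
  have [y yb] := rep_val_surj (b tt); exists y => i.
  case: (GP i) => _ ->; rewrite yb.
  have -> : single (b tt) = b by apply: functional_extensionality_dep => -[].
  by apply: Hb; exists i.
exists (single (rep_val y)) => pf ppf.
have [psi Psi] := home_def_formula (pform pf).
pose z i : {e | A e} := exist A (Tagged (Ceq C) (pval pf i)) (pA _ ppf _ (ex_intro2 _ _ i I erefl)).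
pose h (q : rep_var (sctx (fun _ : unit => s) (psort pf))) : J + 'I_n :=
  let: existT o i := q in
  match o return 'I_(rep_ar (sctx (fun _ : unit => s) (psort pf) o)) -> J + 'I_n with
  | inl _ => fun i => inr i
  | inr k => fun i => inl (existT (fun z => 'I_(rep_ar (tag (sval z)))) (z k) i)
  end i.
have hE (y' : 'I_n -> home C) : rep_env (fun q => match h q with inl j => g j | inr i => y' i end) =
    env_sum (single (rep_val y')) (pval pf).
  apply: functional_extensionality_dep => -[[]|k] //.
  exact: (repE (Tagged (Ceq C) (pval pf k))).
pose cJ := sctx cj cn.
have [chi Chi] : @fodef HL unit (fun=> C) _ cJ (fun _ v =>
    @sat HL C _ (@hctx Sg _)
      (fun q => match h q with inl j => v (inl j) | inr i => v (inr i) end) psi).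
  apply: fodef_sat => q; case: (h q) => [j|i].
    by exists (Var cJ (inl j)).
  by exists (Var cJ (inr i)).
have chiE (y' : 'I_n -> home C) : @sat HL C _ cJ (@env_sum HL C _ _ cj cn g y') chi <->
    psat (single (rep_val y')) pf.
  by rewrite (Chi tt) Psi /psat -hE.
by rewrite -chiE; apply: Hy; exists pf.
Qed.

(** The sort of a home term is an arbitrary [s] in [unit], and [C s] is [home C] only after case
    analysis on [s]. *)
Definition home_of (s : unit) : C s -> home C := match s with tt => id end.

Definition to_home (s : unit) : home C -> C s := match s with tt => id end.

Lemma to_homeK (s : unit) (a : C s) : to_home s (home_of a) = a.
Proof. by case: s a. Qed.

Lemma tmdef_home_term (X : Type) (ctx : X -> unit) (s : unit)
    (t : @term HL X ctx s) :
  @tmdef EL unit (fun=> Ceq C) X (fun=> None) None (fun _ v =>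
    home_of (@eval HL C X ctx (fun x => to_home (ctx x) (v x)) s t)).
Proof.
elim: t => {s} [x|f args IH].
  exists (@Var EL X (fun=> None) x) => _ v /=.
  by move: (v x); case: (ctx x).
have /dep_choice[h Hh] := IH.
exists (@App EL X (fun=> None) (inl f) h) => i v.
rewrite [LHS]/=; congr (@fint HL C f).
by apply: functional_extensionality_dep => k; exact: Hh.
Qed.

Lemma fodef_home_formula (X : Type) (ctx : X -> unit) (phi : @formula HL X ctx) :
  @fodef EL unit (fun=> Ceq C) X (fun=> None) (fun _ v =>
    @sat HL C X ctx (fun x => to_home (ctx x) (v x)) phi).
Proof.
elim: phi => {X ctx} [X ctx|X ctx s t u|X ctx r args|X ctx p P q Q|X ctx s p IH].
- exact: fodef_false.
- apply: fodef_ext (fodef_eq (tmdef_home_term t) (tmdef_home_term u)) => _ v /=.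
  split=> [->//|H].
  by rewrite -[LHS]to_homeK H to_homeK.
- exact: (@fodef_rel EL unit (fun=> Ceq C) X (fun=> None) r _ (fun k => tmdef_home_term (args k))).
- exact: fodef_imp.
- case: s p IH => p IH /=.
  apply: (@fodef_all EL unit (fun=> Ceq C) X (fun=> None) None (fun _ v b =>
    @sat HL C (option X) (oapp ctx tt)
      (@env_bind HL C X ctx tt (fun x => to_home (ctx x) (v x)) b) p)).
  apply: fodef_ext (@fodef_subst EL unit (fun=> Ceq C) _ (fun=> None) _
    (oapp (fun=> None) None) _ (fun _ v o => match o return Ceq C None with
       | Some x => v (Some x) | None => v None end) IH _); last first.
    by case=> [x|]; [exists (@Var EL _ (oapp (fun=> None) None) (Some x))|
      exists (@Var EL _ (oapp (fun=> None) None) None)].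
  move=> _ v.
  suff -> : @env_bind HL C X ctx tt (fun x => to_home (ctx x) (v (Some x))) (v None) =
    (fun o => to_home (oapp ctx tt o) match o return Ceq C None with
       | Some x => v (Some x) | None => v None end) by [].
  by apply: functional_extensionality_dep => -[].
Qed.

Lemma tmdef_home_of (X : Type) (ctx : X -> unit) (s : unit)
    (F : forall i : unit, env C ctx -> C s) :
  @tmdef HL unit (fun=> C) X ctx s F ->
  @tmdef HL unit (fun=> C) X ctx tt (fun i v => home_of (F i v)).
Proof. by case: s F. Qed.

(** Formulas over [A] translate in both directions between the home language and [eq_lang], so [b]
    has the same conjugates for both. *)
Lemma hacl_acl (A : set (home C)) (b : home C) :
  hacl A b <-> acl (in_eq A) (@Tagged _ None (Ceq C) b).
Proof.
rewrite /hacl /= !aclE.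
suff H b' : @eqv HL C C _ _ (env_bind (@elt_env HL C (on_sort (A : set (C tt)))) (b : C tt))
       (env_bind (@elt_env HL C (on_sort (A : set (C tt)))) (b' : C tt)) <->
    @eqv EL (Ceq C) (Ceq C) _ _ (env_bind (@elt_env EL (Ceq C) (in_eq A)) (b : Ceq C None))
       (env_bind (@elt_env EL (Ceq C) (in_eq A)) (b' : Ceq C None)).
  by split; apply: sub_finite_set => b' /= /H.
(* The default [b] on imaginary sorts is never reached: [val_of] is used only on elements of the
   home sort. *)
pose val_of (e : elt (Ceq C)) : home C :=
  match tag e as s return Ceq C s -> home C with None => id | Some _ => fun=> b end (tagged e).
have to_eq e : on_sort (A : set (C tt)) e ->
    in_eq A (@Tagged _ None (Ceq C) (home_of (tagged e))).
  by move=> [a Aa <-]; exists a.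
have to_hm e : in_eq A e -> on_sort (A : set (C tt)) (@Tagged unit tt C (val_of e)).
  by move=> [a Aa <-]; exists a.
split=> H phi.
  have [psi P] := home_def_formula phi.
  pose h (q : rep_var (oapp (@elt_ctx EL (Ceq C) (in_eq A)) None)) :
      option {e | on_sort (A : set (C tt)) e} :=
    match tag q with Some e => Some (exist _ _ (to_hm _ (svalP e))) | None => None end.
  have hE a : rep_env (fun q => match h q with
        | Some e => val_of (@Tagged _ None (Ceq C) (home_of (tagged (sval e)))) | None => a end) =
      env_bind (@elt_env EL (Ceq C) (in_eq A)) (a : Ceq C None).
    apply: functional_extensionality_dep => -[[e eA]|] //.
    by case: (eA) => a' Aa' e'; subst e.
  pose cH := oapp (@elt_ctx HL C (on_sort (A : set (C tt)))) tt.
  have [chi Chi] : @fodef HL unit (fun=> C) _ cH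
    (fun _ v => @sat HL C _ (@hctx Sg _) (fun q => home_of (v (h q))) psi).
    apply: fodef_sat => q; apply: tmdef_home_of.
    by exists (Var cH (h q)).
  have chiE a :
      @sat HL C _ cH (env_bind (@elt_env HL C (on_sort (A : set (C tt)))) (a : C tt)) chi <->
      sat (env_bind (@elt_env EL (Ceq C) (in_eq A)) (a : Ceq C None)) phi.
    rewrite (Chi tt) -hE -P.
    suff -> : (fun q => home_of
        (env_bind (@elt_env HL C (on_sort (A : set (C tt)))) (a : C tt) (h q))) =
      (fun q => match h q with
        | Some e => val_of (@Tagged _ None (Ceq C) (home_of (tagged (sval e)))) | None => a end) by [].
    by apply: functional_extensionality_dep => q; case: (h q).
  by rewrite -!chiE.
have [psi P] := fodef_home_formula phi.
pose cE := oapp (@elt_ctx EL (Ceq C) (in_eq A)) None.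
have [chi Chi] : @fodef EL unit (fun=> Ceq C) _ cE (fun _ v => @sat EL (Ceq C) _ (fun=> None)
    (fun o => match o return Ceq C None with
       | Some e => v (Some (exist _ _ (to_eq _ (svalP e)))) | None => v None end) psi).
  apply: fodef_sat => -[e|]; first by exists (Var cE (Some (exist _ _ (to_eq _ (svalP e))))).
  by exists (Var cE None).
have chiE a : sat (env_bind (@elt_env EL (Ceq C) (in_eq A)) (a : Ceq C None)) chi <->
    @sat HL C _ _ (env_bind (@elt_env HL C (on_sort (A : set (C tt)))) (a : C tt)) phi.
  rewrite (Chi tt) (P tt).
  set v := (X in sat X phi); set w := (X in _ <-> sat X phi).
  suff -> : v = w by [].
  by apply: functional_extensionality_dep => -[[[[] e] Ae]|].
by rewrite -!chiE.
Qed.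

End Imaginaries.

(** * Small elementary submodels *)

(** It tells apart the formulas [iter k (Imp (Bot _)) (Bot _)], which serve as names of the natural
    numbers. *)
Fixpoint imp_depth (L : language) (X : Type) (ctx : X -> sort L)
    (phi : formula ctx) : nat :=
  if phi is Imp _ psi then (imp_depth psi).+1 else 0.

Lemma imp_depth_iter (L : language) (X : Type) (ctx : X -> sort L) (k : nat) :
  imp_depth (iter k (Imp (Bot ctx)) (Bot ctx)) = k.
Proof. by elim: k => //= k ->. Qed.

Lemma bound_infinite (Sg : signature) (M : hstruct Sg) :
  infinite_set [set: bound M].
Proof.
apply/infinite_inj_ord => k.
exists (fun i : 'I_k => inl (iter i (Imp (Bot _)) (Bot (@hctx Sg nat)))).
split=> // i i' [] /(congr1 (fun phi => imp_depth phi)).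
by rewrite !imp_depth_iter => /val_inj.
Qed.

Lemma elementary_Th (Sg : signature) (M C : hstruct Sg) (j : home M -> home C) :
  elementary j -> forall phi, holds M phi <-> holds C phi.
Proof.
move=> jel phi.
pose h (x : void) : @term (home_lang Sg) 'I_0 (@hctx Sg 'I_0) (of_void unit x) :=
  match x with end.
have v0 (N : hstruct Sg) : 'I_0 -> home N by case.
have E (N : hstruct Sg) (v : 'I_0 -> home N) : holds N phi <->
    @sat (home_lang Sg) N _ (@hctx Sg 'I_0) v (fsubst phi h).
  rewrite sat_fsubst /holds.
  suff -> : (fun x => eval (v : env N (@hctx Sg 'I_0)) (h x)) =
    (fun x : void => match x return N (of_void _ x) with end) by [].
  by apply: functional_extensionality_dep => -[].
by rewrite (E M (v0 M)) (E C (fun i => j (v0 M i))) jel.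
Qed.

Lemma sval_inj (T : Type) (P : T -> Prop) (x y : {t | P t}) : sval x = sval y -> x = y.
Proof. by case: x y => x Px [y Py] /= xy; exact: eq_exist. Qed.

(* The elements of the Skolem hull of a sequence are coded by formulas, which
   bounds its cardinality: [Imp p q] codes the Skolem function of [p] at the
   list of elements coded by [q]. *)
Section Hull.
Variables (Sg : signature) (C : hstruct Sg) (e : nat -> home C).

Local Notation HL := (home_lang Sg).

Definition list_env (b : home C) (l : seq (home C)) (k : nat) : home C :=
  if k is k'.+1 then nth (e 0) l k' else b.

Definition skolem (phi : formula (@hctx Sg nat)) (l : seq (home C)) : home C :=
  match pselect (exists b, @sat HL C nat (@hctx Sg nat) (list_env b l) phi) with
  | left H => sval (cid H)
  | right _ => e 0
  end.

Lemma skolemP (phi : formula (@hctx Sg nat)) (l : seq (home C)) (b : home C) :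
  @sat HL C nat (@hctx Sg nat) (list_env b l) phi ->
  @sat HL C nat (@hctx Sg nat) (list_env (skolem phi l) l) phi.
Proof.
rewrite /skolem; case: pselect => [H _|N H]; first exact: (svalP (cid H)).
by case: N; exists b.
Qed.

(** The two components are the element and the list coded by the same formula; [All] codes a seed
    through the depth of its body. Recursion runs over arbitrary contexts but descends only through
    [Imp], which keeps the context, so [skolem], tied to the context [nat], enters as the argument
    [sk]. *)
Fixpoint decode (X : Type) (ctx : X -> unit) (phi : @formula HL X ctx)
    (sk : @formula HL X ctx -> seq (home C) -> home C) : home C * seq (home C) :=
  match phi with
  | Imp p q => (sk p (decode q sk).2, (decode p sk).1 :: (decode q sk).2)
  | All _ p => (e (imp_depth p), [::])
  | _ => (e 0, [::])
  end.

Definition hull : set (home C) :=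
  [set (@decode nat (@hctx Sg nat) phi skolem).1 | phi in [set: formula (@hctx Sg nat)]].

Lemma hull_seed (k : nat) : hull (e k).
Proof.
exists (All (s := tt : sort HL) (iter k (Imp (Bot _)) (Bot _))) => //=.
by rewrite imp_depth_iter.
Qed.

Lemma hull_skolem (phi : formula (@hctx Sg nat)) (l : seq (home C)) :
  (forall k, k < size l -> hull (nth (e 0) l k)) -> hull (skolem phi l).
Proof.
move=> hl; have [psi P] : exists psi, (@decode nat (@hctx Sg nat) psi skolem).2 = l.
  elim: l hl => [|a l IH] hl; first by exists (Bot _).
  have [|q <-] := IH; first by move=> k kl; exact: (hl k.+1).
  by have [p _ /= <-] := hl 0 (ltn0Sn _); exists (Imp p q).
by exists (Imp phi psi) => //=; rewrite P.
Qed.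

Lemma list_env_ord n (b : home C) (w : 'I_n -> home C) (i : 'I_n) :
  list_env b [seq w k | k <- enum 'I_n] i.+1 = w i.
Proof. by rewrite /= (nth_map i) ?size_enum_ord // nth_ord_enum. Qed.

Lemma hull_skolem_ord n (phi : formula (@hctx Sg nat)) (w : 'I_n -> home C) :
  (forall i, hull (w i)) -> hull (skolem phi [seq w k | k <- enum 'I_n]).
Proof.
move=> hw; apply: hull_skolem => k; rewrite size_map size_enum_ord => kn.
by have := list_env_ord (e 0) w (Ordinal kn); rewrite /= => ->.
Qed.

Lemma hull_fint (f : sg_fun Sg) (w : 'I_(sg_far f) -> home C) :
  (forall i, hull (w i)) -> hull (@fint HL C f w).
Proof.
move=> hw; pose cN := @hctx Sg nat.
pose phi := @Eq HL nat cN tt (Var cN 0) (@App HL nat cN f (fun i => Var cN i.+1)).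
have := @skolemP phi [seq w k | k <- enum 'I_(sg_far f)] (@fint HL C f w).
have E : (fun i : 'I_(sg_far f) => nth (e 0) [seq w k | k <- enum 'I_(sg_far f)] i) = w.
  by apply: functional_extensionality_dep => i; exact: (list_env_ord (e 0) w i).
rewrite /= E => <- //; exact: hull_skolem_ord.
Qed.

Definition hull_struct : hstruct Sg :=
  @Structure HL (fun s => {c : C s | hull (home_of c)})
    (fun f v => exist _ (@fint HL C f (fun i => sval (v i)))
       (hull_fint (fun i => svalP (v i))))
    (fun r v => @rint HL C r (fun i => sval (v i))).

Definition hull_incl (a : home hull_struct) : home C := sval a.

Lemma eval_hull (X : Type) (ctx : X -> unit) (v : env hull_struct ctx)
    (s : unit) (t : @term HL X ctx s) :
  sval (eval v t) = eval (fun x => sval (v x) : C (ctx x)) t.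
Proof.
elim: t => {s} [//|f args IH] /=.
suff -> : (fun i => sval (eval v (args i))) =
  (fun i => eval (fun x => sval (v x) : C (ctx x)) (args i)) by [].
by apply: functional_extensionality_dep => i; exact: IH.
Qed.

(** The Tarski-Vaught test: a counterexample in [C] to a universal formula can be replaced by the
    Skolem value of the negated formula, which lies in the hull. *)
Lemma sat_hull (X : Type) (ctx : X -> unit) (phi : @formula HL X ctx)
    (v : env hull_struct ctx) :
  sat v phi <-> sat (fun x => sval (v x) : C (ctx x)) phi.
Proof.
elim: phi v => {X ctx} [//|X ctx s t u|X ctx r args|X ctx p P q Q|X ctx s p IH] v /=.
- rewrite -!eval_hull; by split=> [->//|]; exact: sval_inj.
- suff -> : (fun i => sval (eval v (args i))) =
    (fun i => eval (fun x => sval (v x) : C (ctx x)) (args i)) by [].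
  by apply: functional_extensionality_dep => i; exact: eval_hull.
- by rewrite P Q.
have bindE b : (fun o => sval (env_bind v b o) : C (oapp ctx s o)) =
    env_bind (fun x => sval (v x) : C (ctx x)) (sval b).
  by apply: functional_extensionality_dep => -[].
split=> H b; last by apply/IH; rewrite bindE.
have {}H a (ha : hull (home_of a)) : sat (env_bind (fun x => sval (v x) : C (ctx x)) a) p.
  by have := H (exist _ a ha); rewrite IH bindE.
apply: contrapT => N.
(* [skolem] takes formulas in variables numbered by [nat], so [p] is cut down to finitely many
   parameters, numbered from 1; the quantified variable gets number 0. *)
have [psi Psi] : @fodef HL (structure HL) id (unit + X) (sctx (fun=> s) ctx)
   (fun _ u => sat (env_bind (fun x => u (inr x)) (u (inl tt))) p).
  apply: fodef_sat => -[x|]; first by exists (Var (sctx (fun=> s) ctx) (inr x)).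
  by exists (Var (sctx (fun=> s) ctx) (inl tt)).
have [n [h [chi Chi]]] := fm_params_finite psi.
have [th Th] : @fodef HL unit (fun=> C) nat (@hctx Sg nat) (fun _ u =>
    ~ sat (env_sum (single (to_home s (u 0))) (fun i => to_home (ctx (h i)) (u i.+1))) chi).
  apply: fodef_not; apply: fodef_sat => -[x|i] /=.
    by case: {+}s; exists (Var (@hctx Sg nat) 0).
  by case: (ctx (h i)); exists (Var (@hctx Sg nat) i.+1).
pose w i := home_of (sval (v (h i))).
have thE a : @sat HL C nat (@hctx Sg nat) (list_env a [seq w k | k <- enum 'I_n]) th <->
    ~ sat (env_bind (fun x => sval (v x) : C (ctx x)) (to_home s a)) p.
  rewrite (Th tt) -(Psi C (env_sum (single (to_home s a)) (fun x => sval (v x) : C (ctx x)))) Chi.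
  have -> // : (fun i => to_home (ctx (h i)) (list_env a [seq w k | k <- enum 'I_n] i.+1)) =
    (fun i => sval (v (h i)) : C (ctx (h i))).
  by apply: functional_extensionality_dep => i; rewrite list_env_ord to_homeK.
have := @skolemP th [seq w k | k <- enum 'I_n] (home_of b).
rewrite !thE to_homeK => /(_ N); apply; apply: H.
have -> : home_of (to_home s (skolem th [seq w k | k <- enum 'I_n])) =
  skolem th [seq w k | k <- enum 'I_n] by case: {+}s.
by apply: hull_skolem_ord => i; exact: (svalP (v (h i))).
Qed.

Lemma hull_elementary : elementary hull_incl.
Proof. by move=> n phi v; exact: sat_hull. Qed.

(** Elements of the hull are coded by formulas, so formulas alone dominate the bound; the two
    different premises put in front keep both summands apart. Saturation and homogeneity relative to
    [bound M] thus pass to the hull. *)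
Lemma bound_hull (M : hstruct Sg) : [set: bound hull_struct] #<= [set: bound M].
Proof.
have /dep_choice[code codeP] (a : home hull_struct) : exists phi,
    (@decode nat (@hctx Sg nat) phi skolem).1 = hull_incl a.
  by case: (svalP a) => phi _ H; exists phi.
apply/card_leTP; first by constructor; left; exact: Bot.
exists (fun x => match x with
   | inl phi => inl (Imp (Bot _) phi)
   | inr a => inl (Imp (Imp (Bot _) (Bot _)) (code a)) end) => -[p|a] [q|b] _ _ //.
  by case=> ->.
case=> e'; congr inr; apply: sval_inj.
by have := codeP b; rewrite -e' codeP.
Qed.

End Hull.

Lemma small_le (lam lam' : Type) (L : language) (S : structure L) (A : set (elt S)) :
  [set: lam] #<= [set: lam'] -> small lam A -> small lam' A.
Proof. by move=> le; move=> /card_le_trans; apply. Qed.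

Lemma hull_monster (Sg : signature) (N C : hstruct Sg) (j : home N -> home C)
    (e : nat -> home C) : monster j -> monster (@hull_incl Sg C e).
Proof.
case=> jel Csat Chom; split; first exact: hull_elementary.
- move=> A s p /(small_le (bound_hull e N)); exact: Csat.
- move=> A h /(small_le (bound_hull e N)); exact: Chom.
Qed.

(** The imaginary is definable from a representative, and the hull seeded with it is a model of [T]
    whose monster model is still [C]. *)
Lemma geometric_EI_monster (Sg : signature) (T : set (sentence (home_lang Sg)))
    (N C : hstruct Sg) (j : home N -> home C) (c0 : home C) :
  geometric_EI T -> models N T -> monster j ->
  forall e : elt (Ceq C), exists x : set (home C), finite_set x /\
    acl [set e] = acl (in_eq x).
Proof.
move=> EI NT jm [s a]; have [r ra] := rep_val_surj a.
(* The coordinates of the representative, padded by [c0] to an infinite sequence. *)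
pose seed k := if insub k is Some i then r i else c0.
have seedE (i : 'I_(rep_ar s)) : seed i = r i.
  rewrite /seed; case: insubP => [i' _ /val_inj -> //|]; by rewrite ltn_ord.
have hr i : exists b : home (hull_struct seed), hull_incl b = r i.
  by rewrite -seedE; exists (exist _ (seed i) (hull_seed seed i)).
have [||x [xfin xE]] := EI _ C (@hull_incl Sg C seed) _ (hull_monster seed jm) (Tagged (Ceq C) a).
- move=> phi /NT; rewrite /Th /=.
  have [jel _ _] := jm.
  by rewrite (elementary_Th jel) -(elementary_Th (@hull_elementary Sg C seed)).
- move=> w.
  pose ctx := sctx (fun _ : unit => s) (fun _ : 'I_(rep_ar s) => None : sort (eq_lang C)).
  (* With [r] as parameters, [psi] defines the single element [a]; for an imaginary sort it uses the
     projection symbol, for the home sort plain equality. *)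
  have [psi Psi] : @fodef (eq_lang C) unit (fun=> Ceq C) (unit + 'I_(rep_ar s)) ctx (fun _ v =>
     v (inl tt) = @rep_val Sg C s (fun i => v (inr i))).
    rewrite {}/ctx; case: s {ra w a seed seedE hr} r => [E|] r.
      apply: fodef_eq; first by exists (Var _ (inl tt)).
      pose cE := sctx (fun _ : unit => Some E) (fun _ : 'I_(eq_ar E) => None : sort (eq_lang C)).
      by exists (@App (eq_lang C) _ cE (inr E) (fun i => @Var (eq_lang C) _ cE (inr i))).
    by apply: fodef_eq; [exists (Var _ (inl tt))|exists (Var _ (inr ord0))].
  pose pf := @PFormula (eq_lang C) (Ceq C) unit (fun=> s) _ _ psi r.
  have pfE w' : psat w' pf <-> w' tt = a by rewrite /psat (Psi tt) /= ra.
  move=> /(_ pf) H; apply: functional_extensionality_dep => -[].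
  apply/pfE; apply: H; split; last by apply/pfE.
  move=> _ [i _ <-]; have [b hb] := hr i.
  by exists (hull_incl b); [exists b|rewrite hb].
exists ((@hull_incl Sg C seed) @` x); split=> //.
exact: finite_image.
Qed.

(** * Exchange in monster models *)

Lemma entries_home (Sg : signature) (S : hstruct Sg) (X : Type) (g : X -> home S) :
  @entries (home_lang Sg) S X (@hctx Sg X) g = on_sort (range g : set (S tt)).
Proof.
apply/seteqP; split=> [_ [x _ <-]|_ [_ [x _ <-] <-]]; last by exists x.
by exists (g x) => //; exists x.
Qed.

Lemma hacl_alg_over (Sg : signature) (S : hstruct Sg) (X : Type) (g : X -> home S)
    (b : home S) :
  @alg_over (home_lang Sg) S X (@hctx Sg X) g tt b -> hacl (range g) b.
Proof. by move/alg_over_acl; rewrite entries_home. Qed.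

Lemma hacl_mono (Sg : signature) (S : hstruct Sg) (A B : set (home S)) :
  A `<=` B -> hacl A `<=` hacl B.
Proof.
by move=> AB b; apply: acl_mono => _ [a Aa <-]; exists a => //; exact: AB.
Qed.

Lemma elementary_eqv (Sg : signature) (M C : hstruct Sg) (j : home M -> home C)
    (X : Type) (v : X -> home M) : elementary j ->
  @eqv (home_lang Sg) M C X (@hctx Sg X) v (fun x => j (v x)).
Proof.
move=> jel phi.
pose c := sctx (@of_void (sort (home_lang Sg))) (@hctx Sg X).
pose psi := @fsubst _ _ _ phi _ c (fun x => Var c (inr x)).
have [n [h [chi Chi]]] := fm_params_finite psi.
pose c' := sctx (@of_void (sort (home_lang Sg))) (@hctx Sg 'I_n).
pose th := @fsubst _ _ _ chi _ (@hctx Sg 'I_n)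
  (fun z => match z return term (@hctx Sg 'I_n) (c' z) with
    | inl x => match x with end | inr i => Var (@hctx Sg 'I_n) i end).
have E (S : hstruct Sg) (u : X -> home S) : @sat _ S _ (@hctx Sg X) u phi <->
   @sat _ S _ (@hctx Sg 'I_n) (fun i => u (h i)) th.
  pose e0 : env S (@of_void (sort (home_lang Sg))) := fun x : void => match x with end.
  have -> : @sat _ S _ (@hctx Sg X) u phi <->
      @sat _ S _ c (env_sum e0 (u : env S (@hctx Sg X))) psi.
    by rewrite sat_fsubst.
  rewrite Chi sat_fsubst.
  set w := (X in sat X chi); set w' := (X in _ <-> sat X chi).
  suff -> : w = w' by [].
  by apply: functional_extensionality_dep => -[].
by rewrite (E M) (E C) jel.
Qed.

Lemma elementary_alg_over (Sg : signature) (M C : hstruct Sg)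
    (j : home M -> home C) (X : Type) (g : X -> home M) (b : home M) :
  elementary j ->
  @alg_over (home_lang Sg) M X (@hctx Sg X) g tt b <->
  @alg_over (home_lang Sg) C X (@hctx Sg X) (fun x => j (g x)) tt (j b).
Proof.
move=> jel; apply: eqv_alg_over.
apply: eqv_subst (elementary_eqv (fun o : option X => oapp g b o) jel) => -[x|].
  by exists (Var (@hctx Sg (option X)) (Some x)).
by exists (Var (@hctx Sg (option X)) None).
Qed.

Definition ocons (T : Type) n (a : T) (v : 'I_n -> T) (i : 'I_n.+1) : T :=
  oapp v a (unlift ord0 i).

Lemma ocons0 (T : Type) n (a : T) (v : 'I_n -> T) : ocons a v ord0 = a.
Proof. by rewrite /ocons unlift_none. Qed.

Lemma oconsS (T : Type) n (a : T) (v : 'I_n -> T) (i : 'I_n) :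
  ocons a v (lift ord0 i) = v i.
Proof. by rewrite /ocons liftK. Qed.

(** The freeness condition of weak saturation, with the parameter dropped. *)
Definition free_tuple (Sg : signature) (S : hstruct Sg) n (v : 'I_n -> home S) :=
  forall i : 'I_n, ~ hacl (v @` [set k : 'I_n | i < k]) (v i).

Lemma free_ocons (Sg : signature) (S : hstruct Sg) n (a : home S) (v : 'I_n -> home S) :
  ~ hacl (range v) a -> free_tuple v -> free_tuple (ocons a v).
Proof.
move=> va vfree i; case: (unliftP ord0 i) => [j|] ->.
  rewrite oconsS => H; apply: (vfree j); apply: hacl_mono H => _ [k /= + <-].
  case: (unliftP ord0 k) => [k'|] -> //; rewrite oconsS /bump !leq0n !add1n ltnS.
  by exists k'.
rewrite ocons0 => H; apply: va; apply: hacl_mono H => _ [k /= + <-].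
by case: (unliftP ord0 k) => [k'|] -> //; rewrite oconsS; exists k'.
Qed.

Section SaturatedHome.
Variables (lam : Type) (Sg : signature) (C : hstruct Sg).
Hypotheses (lam_inf : infinite_set [set: lam]) (C_sat : saturated lam C).

Lemma hacl_trans (A B : set (home C)) (b : home C) :
  finite_set A -> finite_set B -> B `<=` hacl A -> hacl B b -> hacl A b.
Proof.
move=> Afin Bfin BA; apply: (acl_trans lam_inf C_sat).
- by apply: card_le_fin => //; exact: finite_image.
- by apply: card_le_fin => //; exact: finite_image.
- by move=> _ [a Ba <-]; exact: BA.
Qed.

Lemma hacl_self (A : set (home C)) : A `<=` hacl A.
Proof. by move=> a Aa; apply: acl_self; exists a. Qed.

Lemma alg_over_hacl n (g : 'I_n -> home C) (b : home C) : hacl (range g) b ->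
  @alg_over (home_lang Sg) C _ (@hctx Sg 'I_n) g tt b.
Proof.
rewrite /hacl /= -entries_home (acl_alg_over lam_inf C_sat) //.
by apply: card_le_fin => //; apply: finite_image; exact: finite_finset.
Qed.

(** The choice is greedy, an element being prepended only when it is not algebraic over those
    already kept; so the lemma can serve in the proof of exchange itself. *)
Lemma free_tuple_basis (A : set (home C)) : finite_set A ->
  exists n (v : 'I_n -> home C),
    [/\ range v `<=` A, A `<=` hacl (range v) & free_tuple v].
Proof.
move=> /finite_enum[m [h <-]]; elim: m h => [|m IH] h.
  by exists 0, h; split=> // [x [[]]|[]].
have [n [v [vA Av vfree]]] := IH (fun i => h (lift ord0 i)).
have vh : range v `<=` range h by move=> _ /vA[i _ <-]; exists (lift ord0 i).
have [ha|ha] := pselect (hacl (range v) (h ord0)).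
  exists n, v; split=> // _ [i _ <-].
  by case: (unliftP ord0 i) => [k|] -> //; apply: Av; exists k.
exists n.+1, (ocons (h ord0) v); split; last exact: free_ocons.
- move=> _ [i _ <-]; case: (unliftP ord0 i) => [k|] ->.
    by rewrite oconsS; apply: vh; exists k.
  by rewrite ocons0; exists ord0.
- move=> _ [i _ <-]; case: (unliftP ord0 i) => [k|] ->.
    have : hacl (range v) (h (lift ord0 k)) by apply: Av; exists k.
    apply: hacl_mono => _ [k' _ <-]; exists (lift ord0 k') => //; exact: oconsS.
  by apply: hacl_self; exists ord0 => //; rewrite ocons0.
Qed.

End SaturatedHome.

(** Equality of theories makes the empty tuples of [C'] and [C] correspond, and [eqv_ext_tuple]
    copies [v] into [C]. Weak saturation requires freeness over its parameter [c], hence the set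
    [D], although [phi] does not mention [c]. *)
Lemma wsat_free_tuple (Sg : signature) (M C C' : hstruct Sg)
    (j : home M -> home C) (c : home M) : monster j -> weakly_omega_saturated j ->
  (forall phi, holds C' phi <-> holds C phi) ->
  forall n (v : 'I_n -> home C') (phi : formula (@hctx Sg 'I_n)),
  @sat _ C' _ (@hctx Sg 'I_n) v phi -> free_tuple v ->
  exists b : 'I_n -> home M, @sat _ M _ (@hctx Sg 'I_n) b phi /\ free_tuple b.
Proof.
case=> jel C_sat _ wsat CC' n v phi vphi vfree.
pose e0 (S : hstruct Sg) : env S (@of_void (sort (home_lang Sg))) :=
  fun x : void => match x with end.
have inf := @bound_infinite Sg M.
have fin0 : small (bound M) (entries (e0 C)).
  by apply: card_le_fin => //; apply: sub_finite_set (finite_set0 _) => _ [[]].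
have fg : eqv (e0 C') (e0 C).
  have E S : e0 S = (fun x : void => match x return S (of_void _ x) with end).
    by apply: functional_extensionality_dep => -[].
  by move=> psi; rewrite !E; exact: CC'.
pose D : set (elt C) := [set @Tagged unit tt C (j c)].
have Dsm : small (bound M) D by apply: card_le_fin => //; exact: finite_set1.
have [w [vw wD]] := @eqv_ext_tuple _ _ C inf C_sat C' n (@hctx Sg 'I_n) v _ _
   (e0 C') (e0 C) D fin0 Dsm fg.
pose phi' := @fsubst _ _ _ phi _ (@hctx Sg ('I_n + unit))
  (fun i => Var (@hctx Sg ('I_n + unit)) (inl i)).
have E (S : hstruct Sg) (a : 'I_n -> home S) (d : home S) :
    @sat _ S _ (@hctx Sg ('I_n + unit))
      (fun z => match z with inl i => a i | inr _ => d end) phi' <->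
    @sat _ S _ (@hctx Sg 'I_n) a phi by rewrite sat_fsubst.
have [|b [bphi bfree]] := wsat c n phi'.
  exists w; split.
    rewrite E; apply/(_ : eqv v w); last exact: vphi.
    apply: eqv_subst vw => i.
    by exists (Var (sctx (@of_void (sort (home_lang Sg))) (@hctx Sg 'I_n)) (inr i)).
  move=> i H; apply: (wD i).
    rewrite /=; move=> A; apply: (vfree i).
    apply: acl_mono (alg_over_acl A) => _ [[[]|[k ik]] _ <-].
    by exists (v k) => //; exists k.
  apply: acl_mono H => _ [a [[k ik <-]|->] <-]; last by left; right.
  by right; exists k.
exists b; split; first by rewrite -E; exact: bphi.
by move=> i H; apply: (bfree i); apply: hacl_mono H; exact: subsetUl.
Qed.

Lemma monster_exchange (Sg : signature) (M C : hstruct Sg) (j : home M -> home C)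
    (c : home M) (lam : Type) (C' : hstruct Sg) :
  monster j -> weakly_omega_saturated j -> exchange j ->
  infinite_set [set: lam] -> saturated lam C' ->
  (forall phi, holds C' phi <-> holds C phi) ->
  forall (A : set (home C')) (a b : home C'), finite_set A ->
  hacl (A `|` [set b]) a -> ~ hacl A a -> hacl (A `|` [set a]) b.
Proof.
move=> jm wsat exch lam_inf C'_sat CC' A a b Afin Aba Aa; apply: contrapT => Aab.
have [jel C_sat _] := jm.
(* A free tuple with the same closure as [A]; if exchange fails, [b], [a] and [v] together form a
   free tuple. *)
have [n [v [vA Av vfree]]] := free_tuple_basis Afin.
(* The position of [a]; [lift o1] enumerates the positions of [b] and [v]. *)
pose o1 : 'I_n.+2 := lift ord0 ord0.
have range_ocons (T : Type) m (x : T) (y : 'I_m -> T) : range (ocons x y) = range y `|` [set x].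
  apply/seteqP; split=> [_ [i _ <-]|z [[i _ <-]|->]].
  - case: (unliftP ord0 i) => [k|] ->; first by left; rewrite oconsS; exists k.
    by right; rewrite ocons0.
  - by exists (lift ord0 i); rewrite ?oconsS.
  - by exists ord0; rewrite ?ocons0.
have vfin : finite_set (range v) by apply: finite_image; exact: finite_finset.
have ufree : free_tuple (ocons b (ocons a v)).
  apply: free_ocons; [rewrite range_ocons|apply: free_ocons => //].
    by move=> H; apply: Aab; apply: hacl_mono H; exact: setSU.
  by move=> H; apply: Aa; exact: hacl_mono H.
have [th [tha thfin]] : @alg_over (home_lang Sg) C' _ (@hctx Sg 'I_n.+1) (ocons b v) tt a.
  apply: (alg_over_hacl lam_inf C'_sat); rewrite range_ocons.
  apply: (hacl_trans lam_inf C'_sat) Aba.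
  - by rewrite finite_setU; split=> //; exact: finite_set1.
  - by rewrite finite_setU; split=> //; exact: finite_set1.
  - move=> x [Ax|->]; last by apply: hacl_self; right.
    by apply: hacl_mono (Av _ Ax); exact: subsetUl.
(* With fewer than [K] solutions allowed, the algebraicity of [a] over [b] and [v] fits in the one
   formula [phi] that is copied into [M]. *)
have [K KP] : exists k, ~ exists w : 'I_k -> home C', injective w /\
    forall i, sat (env_bind (ocons b v : env C' (@hctx Sg 'I_n.+1)) (w i : C' tt)) th.
  apply: contrapT => H; move: thfin; apply/infinite_inj_ord => k.
  by apply: contrapT => N; apply: H; exists k.
have [th' T] := fodef_atleast th K.
have [phi Phi] : @fodef (home_lang Sg) (structure (home_lang Sg)) id _ (@hctx Sg 'I_n.+2) (fun S u =>
    sat (env_bind (fun i => u (lift o1 i) : S (@hctx Sg 'I_n.+1 i)) (u o1 : S tt)) th /\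
    ~ sat (fun i => u (lift o1 i) : S (@hctx Sg 'I_n.+1 i)) th').
  apply: fodef_and; last first.
    by apply: fodef_not; apply: fodef_sat => i; exists (Var (@hctx Sg 'I_n.+2) (lift o1 i)).
  apply: fodef_sat => -[i|]; first by exists (Var (@hctx Sg 'I_n.+2) (lift o1 i)).
  by exists (Var (@hctx Sg 'I_n.+2) o1).
have alg_phi (S : hstruct Sg) (u : 'I_n.+2 -> home S) : @sat _ S _ (@hctx Sg 'I_n.+2) u phi ->
    @alg_over (home_lang Sg) S _ (@hctx Sg 'I_n.+1) (fun i => u (lift o1 i)) tt (u o1).
  move=> /Phi[th1 th2]; exists th; split=> //; apply: contrapT => /infinite_inj_ord/(_ K) H.
  by apply: th2; rewrite T.
have lift1 (T0 : Type) (x y : T0) (z : 'I_n -> T0) :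
    (fun i => ocons y (ocons x z) (lift o1 i)) = ocons y z.
  apply: functional_extensionality_dep => i.
  case: (unliftP ord0 i) => [k|] ->.
    rewrite oconsS (_ : lift o1 _ = lift ord0 (lift ord0 k)) ?oconsS //.
    exact: val_inj.
  by rewrite ocons0 (_ : lift o1 _ = ord0) ?ocons0 //; exact: val_inj.
have uphi : @sat _ C' _ (@hctx Sg 'I_n.+2) (ocons b (ocons a v)) phi.
  apply/Phi; rewrite lift1 /o1 oconsS ocons0; split=> // /T.
  exact: KP.
have [d [dphi dfree]] := wsat_free_tuple c jm wsat CC' uphi ufree.
pose A' := range (fun i : 'I_n => d (lift ord0 (lift ord0 i))).
have dA' : d @` [set k : 'I_n.+2 | o1 < k] = A'.
  apply/seteqP; split=> [_ [k /= + <-]|_ [k _ <-]];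
    last by exists (lift ord0 (lift ord0 k)).
  case: (unliftP ord0 k) => [k'|] -> //; case: (unliftP ord0 k') => [k''|] -> // _.
  by exists k''.
have dA'1 : d @` [set k : 'I_n.+2 | (ord0 : 'I_n.+2) < k] = A' `|` [set d o1].
  apply/seteqP; split=> [_ [k /= + <-]|_ [[k _ <-]|->]].
  - case: (unliftP ord0 k) => [k'|] -> // _; case: (unliftP ord0 k') => [k''|] ->.
      by left; exists k''.
    by right.
  - by exists (lift ord0 (lift ord0 k)).
  - by exists o1.
have inf := @bound_infinite Sg M.
(* Exchange is given with closure computed in [C], freeness of [d] with closure computed in [M]; a
   witnessing formula goes down along the elementary map [j]. *)
have pull m (g : 'I_m -> home M) x : hacl (j @` range g) (j x) -> hacl (range g) x.
  have -> : j @` range g = range (fun i => j (g i)) by rewrite image_comp.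
  move=> /(alg_over_hacl inf C_sat)/(elementary_alg_over g x jel).
  exact: hacl_alg_over.
(* By [phi], [d o1] is algebraic over [A'] and [d ord0], but it is not algebraic over [A']; exchange
   then contradicts freeness at position 0. *)
apply: (dfree ord0); rewrite dA'1.
have dE : range (fun i => d (lift ord0 i)) = A' `|` [set d o1].
  rewrite -dA'1; apply/seteqP; split=> [_ [k _ <-]|_ [k /= + <-]].
    by exists (lift ord0 k).
  by case: (unliftP ord0 k) => [k'|] -> // _; exists k'.
rewrite -dE; apply: (pull); rewrite dE.
apply: exch; last by move=> /(pull n (fun i => d (lift ord0 (lift ord0 i))));
  rewrite -/A' -dA'; exact: dfree.
have /(elementary_alg_over _ _ jel)/hacl_alg_over := alg_phi M d dphi.
apply: hacl_mono => _ [i _ <-]; exists (d (lift o1 i)) => //.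
case: (unliftP ord0 i) => [k|] ->.
  by left; exists k => //; congr d; exact: val_inj.
by right; congr d; exact: val_inj.
Qed.

(** * The rank *)

(** In an infinite sort the formulas with finitely many exceptions are finitely satisfiable, and a
    common solution is not algebraic. *)
Lemma exists_nonalg (lam : Type) (L : language) (S : structure L) (X : Type)
    (c : X -> sort L) (g : env S c) (s : sort L) :
  saturated lam S -> small lam (entries g) -> infinite_set [set: S s] ->
  exists b : S s, ~ alg_over g b.
Proof.
move=> S_sat gsm s_inf.
pose P := [set psi : formula (oapp c s) | finite_set [set b | ~ sat (env_bind g b) psi]].
have [n F FP|b Hb] := saturated_ex (P := P) S_sat gsm.
  have bad_fin : finite_set (\bigcup_(k in [set: 'I_n]) [set b | ~ sat (env_bind g b) (F k)]).
    by apply: bigcup_finite => [|k _]; [exact: finite_finset|exact: FP].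
  apply: contrapT => N; apply: s_inf; apply: sub_finite_set bad_fin => b _ /=.
  apply: contrapT => N'; apply: N; exists b => k.
  by apply: contrapT => N; apply: N'; exists k.
exists b => -[psi [psib fin]]; suff : sat (env_bind g b) (Imp psi (Bot _)) by apply.
by apply: Hb; apply: sub_finite_set fin => b1 /= /contrapT.
Qed.

Section Rank.
Variables (lam : Type) (Sg : signature) (C : hstruct Sg).
Hypotheses (lam_inf : infinite_set [set: lam]) (C_sat : saturated lam C).

Local Notation EL := (eq_lang C).

Let Ceq_sat : saturated lam (Ceq C) := Ceq_saturated lam_inf C_sat.

Definition home_elt (a : home C) : elt (Ceq C) := @Tagged _ None (Ceq C) a.

Let small_fin (A : set (elt (Ceq C))) : finite_set A -> small lam A.
Proof. exact: card_le_fin. Qed.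

Let small1 (e : elt (Ceq C)) : small lam [set e].
Proof. by apply: small_fin; exact: finite_set1. Qed.

Let smallU (A B : set (elt (Ceq C))) : small lam A -> small lam B -> small lam (A `|` B).
Proof. exact: card_leU. Qed.

(* [u i] raises the dimension of the tuple over [A] when its entries are added
   from the last one to the first. *)
Definition jump (A : set (elt (Ceq C))) N (u : 'I_N -> home C) (i : 'I_N) : Prop :=
  ~ acl (A `|` [set home_elt (u k) | k in [set k : 'I_N | i < k]]) (home_elt (u i)).

Lemma jump_mono (A B : set (elt (Ceq C))) N (u : 'I_N -> home C) (i : 'I_N) :
  A `<=` B -> jump B u i -> jump A u i.
Proof. by move=> AB uB uA; apply: uB; apply: acl_mono uA; exact: setSU. Qed.

Lemma jump_eqv (A : set (elt (Ceq C))) N (u w : 'I_N -> home C) (i : 'I_N) :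
  small lam A ->
  eqv (env_sum (@elt_env EL (Ceq C) A) (@eq_env Sg C _ u))
      (env_sum (@elt_env EL (Ceq C) A) (@eq_env Sg C _ w)) ->
  jump A u i -> jump A w i.
Proof.
move=> Asm uw ui wi; apply: ui; move: wi.
have E (v : 'I_N -> home C) :
    A `|` [set home_elt (v k) | k in [set k : 'I_N | i < k]] =
    entries (env_sum (@elt_env EL (Ceq C) A)
      (@eq_env Sg C _ (fun k : {k : 'I_N | i < k} => v (sval k)))).
  rewrite entries_sum entries_elt_env; congr (_ `|` _).
  by apply/seteqP; split=> [_ [k ik <-]|_ [[k ik] _ <-]]; [exists (exist _ k ik)|exists k].
have sm (v : 'I_N -> home C) : small lam (A `|` [set home_elt (v k) | k in [set k : 'I_N | i < k]]).
  by apply: smallU => //; apply: small_fin; apply: finite_image; exact: finite_finset.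
rewrite !E !(acl_alg_over lam_inf Ceq_sat) -?E //.
apply: (eqv_alg_over _).1.
pose c0 := sctx (@elt_ctx EL (Ceq C) A) (@eq_ctx Sg C 'I_N).
apply: eqv_subst (eqv_sym uw) => -[[x|[k ik]]|].
- by exists (Var c0 (inl x)).
- by exists (Var c0 (inr k)).
- by exists (Var c0 (inr i)).
Qed.

Hypothesis EI : forall e : elt (Ceq C), exists x : set (home C),
  finite_set x /\ acl [set e] = acl (in_eq x).
Hypothesis exch : forall (A : set (home C)) (a b : home C), finite_set A ->
  hacl (A `|` [set b]) a -> ~ hacl A a -> hacl (A `|` [set a]) b.

Lemma in_eqU (A B : set (home C)) : in_eq (A `|` B) = in_eq A `|` in_eq B.
Proof. exact: image_setU. Qed.

Lemma in_eq1 (a : home C) : in_eq [set a] = [set home_elt a].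
Proof. exact: image_set1. Qed.

Lemma acl_exchange (X : set (elt (Ceq C))) (a b : home C) : small lam X ->
  acl (X `|` [set home_elt b]) (home_elt a) -> ~ acl X (home_elt a) ->
  acl (X `|` [set home_elt a]) (home_elt b).
Proof.
move=> Xsm Xba Xa.
have [B0 [B0fin B0X B0a]] := acl_finite_character lam_inf Ceq_sat (smallU Xsm (small1 _)) Xba.
have /dep_choice[x xP] := EI.
(* [X0] is the finite part of [X] that matters, and the home set [Y], collected through [EI], is
   interalgebraic with it; exchange for home sets applies over [Y]. *)
pose X0 := B0 `&` X; pose Y := \bigcup_(e in X0) x e.
have X0fin : finite_set X0 by apply: finite_setIl.
have Yfin : finite_set Y by apply: bigcup_finite => // e _; case: (xP e).
have inYfin : finite_set (in_eq Y) by exact: finite_image.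
have YX : in_eq Y `<=` acl X.
  move=> _ [y [e [_ Xe] ey] <-]; apply: (@acl_mono _ _ [set e]); first by move=> _ ->.
  by case: (xP e) => _ ->; apply: acl_self; exists y.
have XY : X0 `<=` acl (in_eq Y).
  move=> e X0e; apply: (@acl_mono _ _ (in_eq (x e))).
    by move=> _ [y ey <-]; exists y => //; exists e.
  by case: (xP e) => _ <-; exact: acl_self.
have Yab : hacl (Y `|` [set a]) b.
  apply: exch => //.
    apply/hacl_acl; rewrite in_eqU in_eq1.
    apply: (acl_trans lam_inf Ceq_sat) B0a;
      [by apply: smallU => //; exact: small_fin|exact: small_fin|].
    move=> e B0e; have [Xe|->] := B0X e B0e; last by apply: acl_self; right.
    by apply: acl_mono (XY e _) => //; exact: subsetUl.
  move/hacl_acl => H; apply: Xa.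
  by apply: (acl_trans lam_inf Ceq_sat) H => //; exact: small_fin.
move/hacl_acl: Yab; rewrite in_eqU in_eq1.
apply: (acl_trans lam_inf Ceq_sat); [exact: smallU|by apply: smallU => //; exact: small_fin|].
move=> e [/YX|->]; first by apply: acl_mono; exact: subsetUl.
by apply: acl_self; right.
Qed.

(* If no jump were lost, an extension [w] of the type over [B] whose jumps
   persist over all the parameters [e] and [c] of the dividing formulas would
   satisfy some [delta] strongly dividing over [A c]; its parameter [e] is then
   algebraic over [A c w] but not over [A c], and exchanging it with an entry
   of [w] contradicts that this entry is a jump over [e]. *)
Lemma thorn_fork_jump (X : Type) (u : X -> home C) N (h : 'I_N -> X) (s : X -> 'I_N)
    (A B : set (elt (Ceq C))) :
  cancel s h -> A `<=` B -> small lam B ->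
  type_thorn_forks A (tp B (@eq_env Sg C _ u)) ->
  exists i, jump A (fun k => u (h k)) i /\ ~ jump B (fun k => u (h k)) i.
Proof.
move=> sK AB Bsm [phi [uphi [m [delta [div cover]]]]]; apply: contrapT => noloss.
have jAB i : jump A (fun k => u (h k)) i -> jump B (fun k => u (h k)) i.
  by move=> jA; apply: contrapT => jB; apply: noloss; exists i.
have Asm : small lam A by apply: card_le_trans Bsm; exact: subset_card_le.
have /dep_choice[l /dep_choice[c cP]] := div.
pose D := \bigcup_(i in [set: 'I_m]) (range (c i) `|` params (delta i)).
have Dfin : finite_set D.
  apply: bigcup_finite => [|i _]; first exact: finite_finset.
  by rewrite finite_setU; split; apply: finite_image; exact: finite_finset.
have sme : small lam (entries (@elt_env EL (Ceq C) B)) by rewrite entries_elt_env.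
have [w [uw wD]] := @eqv_ext_tuple _ _ _ lam_inf Ceq_sat (Ceq C) N (@eq_ctx Sg C _)
  (fun k => u (h k)) _ _ (@elt_env EL (Ceq C) B) (@elt_env EL (Ceq C) B) D
  sme (small_fin Dfin) (fun=> iff_refl _).
pose cB := sctx (@elt_ctx EL (Ceq C) B) (@eq_ctx Sg C 'I_N).
(* The enumeration [h] may repeat entries of [u]. Equalities belong to the type, so the copy [w]
   repeats in the same places and comes from a tuple [a'] indexed by [X]. *)
have wh k k' : h k = h k' -> w k = w k'.
  move=> hk; apply/(uw (@Eq EL _ cB None (Var cB (inr k)) (Var cB (inr k')))).
  by rewrite /= hk.
pose a' x := w (s x).
have wa k : w k = a' (h k) by apply: wh; rewrite sK.
have a'tp : realizes (tp B (@eq_env Sg C _ u)) (@eq_env Sg C _ a').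
  apply/realizes_eqv; apply: eqv_subst uw => -[x|e]; last by exists (Var cB (inl e)).
  by exists (Var cB (inr (s x))); rewrite /= sK.
have uwA : eqv (env_sum (@elt_env EL (Ceq C) A) (@eq_env Sg C _ (fun k => u (h k))))
    (env_sum (@elt_env EL (Ceq C) A) (@eq_env Sg C _ w)).
  apply: eqv_subst uw => -[[e Ae]|k]; last by exists (Var cB (inr k)).
  by exists (Var cB (inl (exist B e (AB e Ae)))).
have wnojump i : ~ jump A (fun k => u (h k)) i ->
    acl (A `|` [set home_elt (w k) | k in [set k : 'I_N | i < k]]) (home_elt (w i)).
  move=> uj; apply: contrapT => wj; apply: uj.
  by apply: jump_eqv wj => //; exact: eqv_sym uwA.
have wjump i : jump A (fun k => u (h k)) i ->
    ~ acl (B `|` D `|` [set home_elt (w k) | k in [set k : 'I_N | i < k]]) (home_elt (w i)).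
  move=> /jAB uj H; apply: (wD i); last by rewrite entries_elt_env.
  move=> /alg_over_acl; rewrite entries_sum entries_elt_env => H'; apply: uj.
  by apply: acl_mono H' => e [Be|[[k ik] _ <-]]; [left|right; exists k].
have [i a'delta] := cover _ (uphi _ a'tp).
have [nalg [k inc]] := cP i.
pose AC := A `|` range (c i); pose W := [set home_elt (w k) | k in [set: 'I_N]].
have ACsm : small lam AC.
  by apply: smallU => //; apply: small_fin; apply: finite_image; exact: finite_finset.
have Wsm : small lam W by apply: small_fin; apply: finite_image; exact: finite_finset.
(* Otherwise [k] distinct conjugates of the parameter over [AC] and [W] exist; they are conjugates
   over [AC], and [a'] satisfies [delta i] at each of them, against [k]-inconsistency. *)
have alg : algebraic (AC `|` W) (pval (delta i)).
  apply: contrapT => /infinite_inj_ord/(_ k)[p [pinj pP]]; apply: (inc p pinj) => [i'|].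
    move=> psi [psiA psie]; apply: pP; split=> //.
    by apply: subset_trans psiA _; exact: subsetUl.
  exists (@eq_env Sg C _ a') => i'.
  have aW x : (AC `|` W) (home_elt (a' x)) by right; exists (s x).
  pose cW := sctx (psort (delta i)) (@elt_ctx EL (Ceq C) (AC `|` W)).
  have /realizes_eqv pi := pP i'.
  have {}pi : eqv (env_sum (@eq_env Sg C _ a') (pval (delta i)))
      (env_sum (@eq_env Sg C _ a') (p i')).
    apply: eqv_subst pi => -[x|y]; last by exists (Var cW (inl y)).
    by exists (Var cW (inr (exist _ _ (aW x)))).
  by apply/pi; exact: a'delta.
have [y ACy] : exists y, ~ acl AC (Tagged (Ceq C) (pval (delta i) y)).
  apply: contrapT => N'; apply: nalg; apply: algebraic_tuple => y.
  by apply: contrapT => N''; apply: N'; exists y.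
have ACWy := algebraic_tuple_entry lam_inf Ceq_sat y (smallU ACsm Wsm) alg.
set e := Tagged (Ceq C) (pval (delta i) y) in ACy ACWy.
have De : D e by exists i => //; right; exists y.
have [x [xfin xE]] := EI e.
have [b [xb ACb]] : exists b, x b /\ ~ acl AC (home_elt b).
  apply: contrapT => N'; apply: ACy.
  apply: (acl_trans lam_inf Ceq_sat (B := in_eq x)) => //.
  - by apply: small_fin; exact: finite_image.
  - by move=> _ [b xb <-]; apply: contrapT => ACb; apply: N'; exists b.
  - by rewrite -xE; exact: acl_self.
have eb : acl [set e] (home_elt b) by rewrite xE; apply: acl_self; exists b.
(* The home element [b], interalgebraic data for [e], is shown to remain non-algebraic over [AC] as
   the last [q] entries of [w] are added; [q = N] contradicts [ACWy]. *)
suff H q : q <= N ->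
  ~ acl (AC `|` [set home_elt (w k) | k in [set k : 'I_N | N - q <= k]]) (home_elt b).
  apply: (H N) => //; apply: (acl_trans lam_inf Ceq_sat (B := [set e])) eb => //.
    by apply: smallU => //; apply: small_fin; apply: finite_image; exact: finite_finset.
  move=> _ ->; apply: acl_mono ACWy => e' [?|[k' _ <-]]; first by left.
  by right; exists k' => //=; rewrite subnn.
elim: q => [|q IH] qN.
  move=> H; apply: ACb; apply: acl_mono H => e' [//|[k' /= + _]].
  by rewrite subn0 leqNgt ltn_ord.
have pN : N - q.+1 < N by rewrite ltn_subrL (leq_trans _ qN).
pose o := Ordinal pN.
have oE (k' : 'I_N) : (N - q <= k') = (o < k') by rewrite /= -subSn.
pose X' := AC `|` [set home_elt (w k) | k in [set k : 'I_N | o < k]].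
have X'sm : small lam X'.
  by apply: smallU => //; apply: small_fin; apply: finite_image; exact: finite_finset.
have X'b : ~ acl X' (home_elt b).
  move=> H; apply: IH; first exact: ltnW.
  by apply: acl_mono H => e' [?|[k' ok <-]]; [left|right; exists k' => //=; rewrite oE].
move=> H.
have {}H : acl (X' `|` [set home_elt (w o)]) (home_elt b).
  apply: acl_mono H => e' [?|[k' /= + <-]]; first by left; left.
  rewrite leq_eqVlt => /orP[/eqP ok|ok]; last by left; right; exists k'.
  by right; congr (home_elt (w _)); apply: val_inj.
have [jo|/wnojump jo] := pselect (jump A (fun k => u (h k)) o).
  apply: (wjump o jo).
  apply: (acl_trans lam_inf Ceq_sat) (acl_exchange X'sm H X'b).
  - apply: smallU; first by apply: smallU => //; exact: small_fin.
    by apply: small_fin; apply: finite_image; exact: finite_finset.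
  - exact: smallU.
  move=> e' [[[Ae|ce]|we]|->].
  - by apply: acl_self; left; left; exact: AB.
  - by apply: acl_self; left; right; exists i => //; left.
  - by apply: acl_self; right.
  - by apply: acl_mono eb => _ ->; left; right.
apply: X'b; apply: (acl_trans1 lam_inf Ceq_sat X'sm H).
by apply: acl_mono jo; apply: setSU; exact: subsetUl.
Qed.

(** Each forking extension strictly shrinks the set of jumps, by [thorn_fork_jump]. The enumeration
    [h] with section [s] may repeat entries of [u], which later allows a basis to be placed at the
    end. *)
Lemma Uth_ge_jumps (X : Type) n (A : set (elt (Ceq C)))
    (p : set (pformula (Ceq C) (@eq_ctx Sg C X))) :
  @Uth_ge lam EL (Ceq C) X (@eq_ctx Sg C X) omega n A p -> small lam A ->
  forall (u : X -> home C) N (h : 'I_N -> X) (s : X -> 'I_N),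
    realizes p (@eq_env Sg C _ u) -> cancel s h ->
    n <= #|[pred i | `[< jump A (fun k => u (h k)) i >]]|.
Proof.
elim=> {n A p} [n A p n0 _ _|n A p [n_n0 nsucc]
  |n n' A p B q [nn' succ] [v ->] AB Bsm [v' ->] pq fork _ IH] //.
- by case: n n0 => // n /(_ n) []; exact: ltnSn.
(* Every position of [omega] is zero or a successor, so the limit clause cannot occur. *)
- exfalso; case: n n_n0 nsucc => [[]//|n _ /(_ n)[]].
  by split=> [|m]; rewrite /= ?ltnSn // ltnS leq_eqVlt => /orP[/eqP|]; [right|left].
move=> Asm u N h s up sK.
have -> : n' = n.+1.
  apply/eqP; rewrite eqn_leq nn' andbT leqNgt; apply/negP => /succ[|].
    by rewrite /= ltnNge leqnSn.
  by move=> /eqP; rewrite -[in X in _ == X](addn0 n) -addn1 eqn_add2l.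
have v'B : realizes (tp B v') (@eq_env Sg C _ v') by move=> psi [].
apply: leq_ltn_trans (IH Bsm v' N h s v'B sK) _.
have v'p : realizes (tp A v) (@eq_env Sg C _ v') by move=> psi /pq [].
have uv' i : jump A (fun k => v' (h k)) i -> jump A (fun k => u (h k)) i.
  apply: jump_eqv => //.
  move/realizes_eqv: v'p => v'p; move/realizes_eqv: up => up.
  have : eqv (env_sum (@eq_env Sg C _ v') (@elt_env EL (Ceq C) A))
     (env_sum (@eq_env Sg C _ u) (@elt_env EL (Ceq C) A)).
    by move=> psi; rewrite -v'p up.
  pose cA := sctx (@eq_ctx Sg C X) (@elt_ctx EL (Ceq C) A).
  apply: eqv_subst => -[e|k]; first by exists (Var cA (inr e)).
  by exists (Var cA (inl (h k))).
have [i [iA iB]] := thorn_fork_jump sK AB Bsm fork.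
apply: proper_card; apply/properP; split.
  by apply/fintype.subsetP => k; rewrite !inE => jB; apply: (uv'); exact: (jump_mono AB).
by exists i; [rewrite inE; exact: (uv')|apply/negP; rewrite inE].
Qed.

Definition eq_pformula (X : Type) (x : X) (a : home C) :
    pformula (Ceq C) (@eq_ctx Sg C X) :=
  @PFormula EL (Ceq C) X (@eq_ctx Sg C X) 1 (fun=> None)
    (@Eq EL _ (sctx (@eq_ctx Sg C X) (fun _ : 'I_1 => None)) None
       (Var (sctx (@eq_ctx Sg C X) (fun _ : 'I_1 => None)) (inl x))
       (Var (sctx (@eq_ctx Sg C X) (fun _ : 'I_1 => None)) (inr ord0))) (fun=> a).

Lemma eq_pformula_thorn_divides (X : Type) (x : X) (a : home C)
    (A : set (elt (Ceq C))) : small lam A -> ~ acl A (home_elt a) ->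
  thorn_divides A (eq_pformula x a).
Proof.
move=> Asm Aa; have @c : 'I_0 -> elt (Ceq C) by case.
exists 0, c; have -> : A `|` range c = A.
  by apply/seteqP; split=> [e [//|[[]]]|e]; [|left].
split=> [/(algebraic_tuple_entry lam_inf Ceq_sat ord0 Asm)//|].
(* Two distinct values cannot both equal the same entry, hence 2-inconsistency. *)
exists 2 => w winj wA [v vw].
suff /winj : w ord0 = w (lift ord0 ord0) by [].
apply: functional_extensionality_dep => i; rewrite ord1.
exact: etrans (esym (vw ord0 : v x = w ord0 ord0)) (vw (lift ord0 ord0)).
Qed.

Lemma thorn_forks_entry (X : Type) (u : X -> home C) (x : X)
    (A B : set (elt (Ceq C))) : small lam A -> ~ acl A (home_elt (u x)) ->
  B (home_elt (u x)) -> type_thorn_forks A (tp B (@eq_env Sg C _ u)).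
Proof.
move=> Asm Aux Bux; exists (eq_pformula x (u x)); split.
  by move=> v; apply; split=> // _ [i _ <-].
exists 1, (fun=> eq_pformula x (u x)); split=> [_|v vx]; last by exists ord0.
exact: eq_pformula_thorn_divides.
Qed.

Lemma Uth_ge_independent (X : Type) (u : X -> home C) d (x : 'I_d -> X) :
  (forall k : 'I_d, ~ acl [set home_elt (u (x i)) | i in [set i : 'I_d | i < k]]
     (home_elt (u (x k)))) ->
  Uth_ge_nat lam set0 (@eq_env Sg C _ u) d.
Proof.
move=> indep.
pose B k := [set home_elt (u (x i)) | i in [set i : 'I_d | i < k]].
have Bsm k : small lam (B k).
  by apply: small_fin; apply: finite_image; exact: finite_finset.
have -> : set0 = B 0 by apply/seteqP; split=> // e [].
(* Here [r] counts the elements still to be added once the first [k] are parameters. *)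
suff H r k : k + r = d ->
  @Uth_ge lam EL (Ceq C) X (@eq_ctx Sg C X) omega r (B k) (tp (B k) (@eq_env Sg C _ u)) by exact: H.
elim: r k => [|r IH] k kr.
  by apply: Uth_zero; [|exists (@eq_env Sg C _ u)].
have BB : B k `<=` B k.+1 by move=> _ [i /= ik <-]; exists i => //=; exact: ltnW.
have kd : k < d by rewrite -kr addnS ltnS leq_addr.
apply: (@Uth_succ lam EL (Ceq C) X (@eq_ctx Sg C X) omega r r.+1 (B k) _ (B k.+1)
  (tp (B k.+1) (@eq_env Sg C _ u))) => //.
- by split=> [|m]; rewrite /= ?ltnSn // ltnS leq_eqVlt => /orP[/eqP|]; [right|left].
- by exists (@eq_env Sg C _ u).
- by exists (@eq_env Sg C _ u).
- by move=> psi [psiB ?]; split=> //; exact: subset_trans BB.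
- apply: (@thorn_forks_entry _ u (x (Ordinal kd))) => //; first exact: (indep (Ordinal kd)).
  by exists (Ordinal kd) => /=.
- by apply: IH; rewrite addSnnS.
Qed.

(** The forking formula lists the finitely many conjugates [r i] of [a] over [A]. Each has the type
    of [a] over the empty set, so it is not algebraic and equality with it thorn-divides. The
    parameters [r i] may lie outside [A], as [type_thorn_forks] only asks that realizations satisfy
    the formula. *)
Lemma algebraic_thorn_forks (a : home C) (A : set (home C)) :
  ~ hacl set0 a -> hacl A a ->
  type_thorn_forks set0 (tp (in_eq A) (@eq_env Sg C _ (fun _ : unit => a))).
Proof.
move=> a0 /hacl_acl/finite_enum[m [r rE]].
pose cr := sctx (@eq_ctx Sg C unit) (@eq_ctx Sg C 'I_m).
have [psi Psi] : @fodef EL unit (fun=> Ceq C) (unit + 'I_m) cr (fun _ v =>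
    exists i, v (inl tt) = v (inr i)).
  apply: fodef_exon => i.
  by exists (@Eq EL _ cr None (Var cr (inl tt)) (Var cr (inr i))).
pose phi := @PFormula EL (Ceq C) unit (@eq_ctx Sg C unit) m (fun=> None) psi
  (fun i => r i tt).
have phiE v : psat v phi <-> exists i, v tt = r i tt by exact: (Psi tt).
exists phi; split.
  move=> v va; apply/phiE.
  have : range r v by rewrite rE.
  by move=> [i _ <-]; exists i.
exists m, (fun i => eq_pformula tt (r i tt)); split; last by move=> v /phiE[i vi]; exists i.
move=> i; apply: eq_pformula_thorn_divides; first by apply: small_fin; exact: finite_set0.
have ri : realizes (tp (in_eq A) (@eq_env Sg C _ (fun _ : unit => a))) (r i).
  by have : range r (r i) by [exists i]; rewrite rE.
move=> H; apply: a0; apply/hacl_acl; rewrite /in_eq /on_sort image_set0.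
move: H; rewrite -[set0]entries_elt_env !(acl_alg_over lam_inf Ceq_sat) ?entries_elt_env //;
  try by apply: small_fin; exact: finite_set0.
apply: (eqv_alg_over _).1 => //.
move/realizes_eqv: ri => ri.
pose cA := sctx (@eq_ctx Sg C unit) (@elt_ctx EL (Ceq C) (in_eq A)).
apply: eqv_subst (eqv_sym ri) => -[[e []]|].
by exists (Var cA (inl tt)).
Qed.

End Rank.

(** * Algebraic dimension and the value of the rank *)

Lemma alg_independentS (Sg : signature) (C : hstruct Sg) (A B : set (home C)) :
  A `<=` B -> alg_independent B -> alg_independent A.
Proof.
by move=> AB Bind b Ab H; apply: (Bind b (AB b Ab)); apply: hacl_mono H; exact: setSD.
Qed.

(** An independent subset of the largest possible size, at most [n], is also maximal for
    inclusion. *)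
Lemma dim_alg_exists (Sg : signature) (C : hstruct Sg) n (u : 'I_n -> home C) :
  exists d, dim_alg (range u) d.
Proof.
pose P k := exists B : set (home C), [/\ B `<=` range u, alg_independent B & B #= `I_k].
have P0 : exists k, `[< P k >].
  by exists 0; apply/asboolP; exists set0; split=> //; rewrite II0.
have Pn k : `[< P k >] -> k <= n.
  move=> /asboolP[B [Bu _ Bk]]; rewrite -card_le_II -(card_le_eql Bk).
  apply: card_le_trans (subset_card_le Bu) _.
  apply: card_le_trans (card_image_le _ _) _.
  by have /card_le_eql <- := @card_II n; exact: card_lexx.
case: (ex_maxnP P0 Pn) => d /asboolP[B [Bu Bind Bd]] dmax.
exists d, B; split=> // B' BB' B'u B'ind; apply/seteqP; split=> // b B'b.
apply: contrapT => Bb.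
suff /dmax : `[< P d.+1 >] by rewrite ltnn.
apply/asboolP; exists (B `|` [set b]); split.
- by move=> x [/Bu|->] //; exact: B'u.
- by apply: alg_independentS B'ind => x [/BB'|->].
apply/eq_cardSP; exists b; first by right.
suff -> : (B `|` [set b]) `\ b = B by [].
apply/seteqP; split=> [x [[//|->] /=]//|x Bx]; split; first by left.
by move=> xb; apply: Bb; rewrite -xb.
Qed.

Section Conclusion.
Variables (lam : Type) (Sg : signature) (C : hstruct Sg).
Hypotheses (lam_inf : infinite_set [set: lam]) (C_sat : saturated lam C).
Hypothesis EI : forall e : elt (Ceq C), exists x : set (home C),
  finite_set x /\ acl [set e] = acl (in_eq x).
Hypothesis exch : forall (A : set (home C)) (a b : home C), finite_set A ->
  hacl (A `|` [set b]) a -> ~ hacl A a -> hacl (A `|` [set a]) b.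

Lemma thorn_forks_algebraic (a : home C) (A : set (home C)) :
  A #<= [set: lam] -> ~ hacl set0 a ->
  type_thorn_forks set0 (tp (in_eq A) (@eq_env Sg C _ (fun _ : unit => a))) ->
  hacl A a.
Proof.
move=> Asm a0 fork.
have Bsm : small lam (in_eq A) by apply: card_le_trans (card_image_le _ _) Asm.
have [||i [_ iB]] := @thorn_fork_jump lam Sg C lam_inf C_sat EI exch unit (fun=> a)
  1 (fun=> tt) (fun=> ord0) set0 (in_eq A) _ _ Bsm fork => //; first by case.
move/contrapT: iB => H; apply/hacl_acl; apply: acl_mono H => e [//|[k /=]].
by rewrite !ord1.
Qed.

(** If [a] were outside the closure of [B], adding it would keep independence: an element [b] of [B]
    that becomes algebraic could be exchanged with [a], putting [a] in the closure of [B]. *)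
Lemma dim_alg_span n (u : 'I_n -> home C) (B : set (home C)) :
  B `<=` range u -> alg_independent B ->
  (forall B', B `<=` B' -> B' `<=` range u -> alg_independent B' -> B' = B) ->
  range u `<=` hacl B.
Proof.
move=> Bu Bind Bmax a ua; apply: contrapT => Ba.
have Bfin : finite_set B.
  by apply: sub_finite_set Bu _; apply: finite_image; exact: finite_finset.
have Ba' : ~ B a by move=> H; apply: Ba; exact: hacl_self.
suff ind : alg_independent (B `|` [set a]).
  have Bau : B `|` [set a] `<=` range u by move=> x [/Bu|->].
  by apply: Ba'; rewrite -(Bmax _ (@subsetUl _ B [set a]) Bau ind); right.
move=> b [Bb|->] H; last first.
  by apply: Ba; apply: hacl_mono H => x [[//|->] /=].
have ab : a <> b by move=> ab; apply: Ba'; rewrite ab.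
apply: Ba; have : hacl (B `\ b `|` [set b]) a.
  apply: exch; [exact: finite_setD| |exact: Bind].
  by apply: hacl_mono H => x [[Bx|->] xb]; [left|right].
by apply: hacl_mono => x [[]|->].
Qed.

Lemma Uth_dim_alg n (u : 'I_n -> home C) d : dim_alg (range u) d ->
  Uth_eq_nat lam set0 (@eq_env Sg C _ u) d.
Proof.
move=> [B [Bu Bind Bmax /finite_enum_inj[b [binj bB]]]].
have /dep_choice[x xb] k : exists i, u i = b k.
  by have [|i _] := Bu (b k); [rewrite -bB; exists k|exists i].
split.
  apply: (Uth_ge_independent lam_inf C_sat (x := x)) => k H.
  have Bk : B (b k) by rewrite -bB; exists k.
  apply: (Bind _ Bk); apply/hacl_acl; rewrite -(xb k).
  apply: acl_mono H => _ [i /= ik <-]; exists (u (x i)) => //.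
  rewrite !xb; split; first by rewrite -bB; exists i.
  by move=> /= /binj ik'; rewrite ik' ltnn in ik.
(* The tuple [u] followed by a copy of the basis. Every entry of the first block is algebraic over
   the second, which comes later, so all jumps lie in the last [d] positions. *)
pose h (k : 'I_(n + d)) := match fintype.split k with inl i => i | inr i => x i end.
have sK : cancel (lshift d) h.
  by move=> i; rewrite /h -[lshift d i]/(unsplit (inl i)) unsplitK.
have hr i : h (rshift n i) = x i.
  by rewrite /h -[rshift n i]/(unsplit (inr i)) unsplitK.
move=> /(Uth_ge_jumps lam_inf C_sat EI exch)/(_ _ u _ h (lshift d)) H.
have : d.+1 <= #|[pred i | `[< jump set0 (fun k => u (h k)) i >]]|.
  by apply: H => // [|psi []//]; apply: card_le_fin => //; exact: finite_set0.
apply/negP; rewrite -leqNgt -[X in _ <= X]card_ord -(card_codom (@rshift_inj n d)).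
apply: subset_leq_card; apply/fintype.subsetP => i; rewrite !inE => ij.
case: (split_ordP i) => k ik; last by rewrite ik; exact: codom_f.
exfalso; apply: ij; rewrite {i}ik sK.
have : hacl B (u k) by apply: (dim_alg_span Bu Bind Bmax); exists k.
move/hacl_acl; apply: acl_mono => _ [a + <-]; rewrite -bB => -[i _ <-].
right; exists (rshift n i); last by rewrite hr xb.
by rewrite /= (leq_trans (ltn_ord k)) // leq_addr.
Qed.

Lemma Uth_ge_one : infinite_set [set: home C] ->
  exists a : home C, Uth_ge_nat lam set0 (@eq_env Sg C _ (fun _ : unit => a)) 1.
Proof.
move=> C_inf; have @g : 'I_0 -> home C by case.
have gsm : small lam (@entries (home_lang Sg) C _ (@hctx Sg 'I_0) g).
  by apply: card_le_fin => //; apply: finite_image; exact: finite_finset.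
have [a ga] := @exists_nonalg lam (home_lang Sg) C _ (@hctx Sg 'I_0) g tt C_sat gsm C_inf.
exists a; apply: (Uth_ge_independent lam_inf C_sat (x := fun _ : 'I_1 => tt)) => k H.
apply: ga; apply: (alg_over_hacl lam_inf C_sat); apply/hacl_acl.
by apply: acl_mono H => e [i]; rewrite /= !ord1.
Qed.

Lemma Uth_le_one (a : home C) :
  Uth_le_nat lam set0 (@eq_env Sg C _ (fun _ : unit => a)) 1.
Proof.
move=> /(Uth_ge_jumps lam_inf C_sat EI exch)/(_ _ (fun=> a) 1 (fun=> tt) (fun=> ord0)) H.
have : 2 <= #|[pred i | `[< jump set0 (fun k : 'I_1 => a) i >]]|.
  by apply: H => // [|psi []//|[]//]; apply: card_le_fin => //; exact: finite_set0.
apply/negP; rewrite -leqNgt; apply: leq_trans (max_card _) _.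
by rewrite card_ord.
Qed.

End Conclusion.

Lemma elementary_inj (Sg : signature) (M C : hstruct Sg) (j : home M -> home C) :
  elementary j -> injective j.
Proof.
move=> jel x y jxy.
pose c2 := @hctx Sg 'I_2.
pose phi := @Eq (home_lang Sg) _ c2 tt (Var c2 ord0) (Var c2 (lift ord0 ord0)).
have := jel 2 phi (fun i => if i == ord0 then x else y).
by rewrite /= => -[_ ->].
Qed.

Lemma models_monster_Th (Sg : signature) (M C N C' : hstruct Sg)
    (j : home M -> home C) (j' : home N -> home C') :
  monster j -> models N (Th M) -> monster j' ->
  forall phi, holds C' phi <-> holds C phi.
Proof.
move=> [jel _ _] NM [jel' _ _] phi.
rewrite -(elementary_Th jel) -(elementary_Th jel'); split; last exact: NM.
move=> Nphi; apply: contrapT => Mphi.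
by have := NM (Imp phi (Bot _)) Mphi; apply.
Qed.

Theorem theorem3p2p1 (Sg : signature) (M C : hstruct Sg)
  (j : home M -> home C)
  (M_infinite : infinite_set [set: home M])
  (C_monster : monster j)
  (M_wsat : weakly_omega_saturated j)
  (M_exchange : exchange j)
  (M_weak_EI : weak_EI M) :
  [/\ thorn_minimal (Th M),
      global_Uth_rank (bound M) C 1 &
      forall (n : nat) (A : 'I_n -> home M),
        (exists d : nat, dim_alg (range (fun i => j (A i))) d) /\
        (forall d : nat, dim_alg (range (fun i => j (A i))) d ->
           Uth_eq_nat (bound M) set0 (eq_env (fun i => j (A i))) d)].
Proof.
have [c _] := infinite_setN0 M_infinite.
have [jel C_sat _] := C_monster.
have inf := @bound_infinite Sg M.
have EI := geometric_EI_monster (j c) M_weak_EI (fun _ => id) C_monster.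
have exch := monster_exchange c C_monster M_wsat M_exchange inf C_sat (fun=> iff_refl _).
(* This excludes rank 0, which is what a finite structure has, all its elements being algebraic. *)
have C_inf : infinite_set [set: home C].
  have [s [sinj _]] := infinite_injnat M_infinite.
  apply/infinite_inj_ord => k; exists (fun i : 'I_k => j (s i)); split=> // i i'.
  by move=> /(elementary_inj jel)/sinj/val_inj.
split.
- move=> N C' j' NM C'_monster a A a0.
  have [jel' C'_sat _] := C'_monster.
  have inf' := @bound_infinite Sg N.
  have EI' := geometric_EI_monster (j' a) M_weak_EI NM C'_monster.
  have exch' := monster_exchange c C_monster M_wsat M_exchange inf' C'_sat
    (models_monster_Th C_monster NM C'_monster).
  split; last exact: (algebraic_thorn_forks inf' C'_sat).
  apply: (thorn_forks_algebraic inf' C'_sat EI' exch') => //.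
  (* The parameters come from [N], hence are small for the bound of its monster model. *)
  apply: card_le_trans (card_image_le _ _) _.
  apply/card_leTP; first by constructor; right; exact: a.
  by exists inr => x y _ _ [].
- split=> [a|m Um]; first exact: Uth_le_one.
  have [a Ua] := Uth_ge_one inf C_sat C_inf.
  by case: m Um => // /(_ a); case.
move=> n A; split; first exact: dim_alg_exists.
by move=> d; exact: Uth_dim_alg.
Qed.
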